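(* Let $X$ be a second countable locally compact Hausdorff space with Borel $\sigma$-algebra $\mathcal B(X)$, $\sigma$ a probability measure on $(X,\mathcal B(X))$ and $\beta>0$. Then for every continuous compactly supported $f\colon X\to\mathbb R$ and every $t\in\mathbb R$, $$\int_{\mathscr P(X)}e^{\mathrm i\,t\int f\,d\eta}\,d\mathcal D_{\beta\sigma}(\eta)=\sum_{n=0}^\infty\frac{(\mathrm i\,t)^n}{n!}\;\frac{n!}{\langle\beta\rangle_n}\;Z_n\Big(\beta\int f^1\,d\sigma,\dots,\beta\int f^n\,d\sigma\Big).$$ Moreover, the map $\nu\mapsto\mathcal D_\nu$ is continuous from the space of non-zero finite non-negative Borel measures on $X$, endowed with the narrow topology, to $\mathscr P(\mathscr P(X))$, endowed with the narrow topology.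
   Context: $\langle\beta\rangle_n=\Gamma(\beta+n)/\Gamma(\beta)$. $\mathscr P(X)$ is the space of Borel probability measures on $X$ and $\mathscr P(\mathscr P(X))$ the space of Borel probability measures on $\mathscr P(X)$; narrow topologies are those induced by duality with bounded continuous functions. $Z_n$ is the cycle index polynomial of the symmetric group $\mathfrak S_n$: $Z_n(t_1,\dots,t_n)=\frac1{n!}\sum_{\pi\in\mathfrak S_n}\prod_{i=1}^nt_i^{\lambda_i(\pi)}$, with $\lambda_i(\pi)$ the number of cycles of length $i$ of $\pi$; $Z_0=1$. For $\boldsymbol\alpha\in\mathbb R^k$ with all entries $>0$, the Dirichlet distribution $D_{\boldsymbol\alpha}$ is the probability measure on $\Delta^{k-1}=\{\mathbf y\in\mathbb R^k:y_i\ge0,\sum_iy_i=1\}$ with density $\frac{\Gamma(\sum_i\alpha_i)}{\prod_i\Gamma(\alpha_i)}\prod_iy_i^{\alpha_i-1}$ with respect to $dy_1\cdots dy_{k-1}$ ($\delta_1$ if $k=1$). For a non-zero finite non-negative Borel measure $\nu$ on $X$, the Dirichlet--Ferguson measure $\mathcal D_\nu$ with intensity $\nu$ is the unique Borel probability measure on $\mathscr P(X)$ such that, for every $k\ge1$ and every partition of $X$ into Borel sets $X_1,\dots,X_k$ with $\nu X_i>0$ for all $i$, the push-forward of $\mathcal D_\nu$ under $\eta\mapsto(\eta X_1,\dots,\eta X_k)$ is $D_{(\nu X_1,\dots,\nu X_k)}$.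
   Formalization: The stated marginals do not determine the Dirichlet–Ferguson measure when ν is a multiple of a point mass, so the definition also requires that νN=0 imply ηN=0 for almost every η; for all other ν this follows from the marginals. *)

(* Defs.v *)
From HB Require Import structures.
From mathcomp Require Import all_boot all_order all_algebra all_fingroup.
From mathcomp Require Import all_classical all_reals all_analysis.
From mathcomp Require Import complex.

Set Implicit Arguments.
Unset Strict Implicit.
Unset Printing Implicit Defensive.
Import Order.TTheory GRing.Theory Num.Theory.
Import numFieldNormedType.Exports.
Local Open Scope classical_set_scope.
Local Open Scope ring_scope.
Local Open Scope complex_scope.

Definition gamma (R : realType) (a : R) : R :=
  \int[lebesgue_measure]_(x in `]0%R, +oo[) (x `^ (a - 1) * expR (- x)).

Definition rising (R : realType) (b : R) (n : nat) : R :=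
  gamma (b + n%:R) / gamma b.

(* [porbits s] counts fixed points as cycles of length 1. *)
Definition ncycles (n : nat) (s : 'S_n) (i : nat) : nat :=
  #|[set c in porbits s | #|c| == i]|%SET.

Definition cycle_index (R : realType) (n : nat) (t : nat -> R) : R :=
  (n`!%:R)^-1 * \sum_(s : 'S_n) \prod_(1 <= i < n.+1) t i ^+ ncycles s i.

Definition cexp (R : realType) (z : R[i]) : R[i] :=
  (expR (complex.Re z))%:C *
  (cos (complex.Im z) +i* sin (complex.Im z)).

Definition cintegral d (T : measurableType d) (R : realType)
    (mu : {measure set T -> \bar R}) (g : T -> R[i]) : R[i] :=
  (\int[mu]_x complex.Re (g x)) +i* (\int[mu]_x complex.Im (g x)).

Definition borel (X : ptopologicalType) : measurableType _ :=
  g_sigma_algebraType (@open X).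

Definition bounded_continuous (R : realType) (X : topologicalType) : Type :=
  {f : X -> R | continuous f /\ exists M : R, forall x, `|f x| <= M}.

HB.instance Definition _ (R : realType) (X : topologicalType) :=
  gen_eqMixin (bounded_continuous R X).
HB.instance Definition _ (R : realType) (X : topologicalType) :=
  gen_choiceMixin (bounded_continuous R X).

(* The codomain carries the topology of pointwise convergence, so the initial
   topology of this map is the narrow one. *)
Definition narrow_eval (R : realType) (X : ptopologicalType)
    (mu : {measure set borel X -> \bar R}) :
    {ptws bounded_continuous R X -> R} :=
  fun f => \int[mu]_x sval f x.

(* Library measures are functions on all sets, so two elements that agree on
   Borel sets but differ elsewhere are distinct; they are topologically
   indistinguishable in the narrow topology. *)
Definition Prob (R : realType) (X : ptopologicalType) : Type :=
  initial_topology
    (fun mu : probability (borel X) R => @narrow_eval R X mu).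

HB.instance Definition _ (R : realType) (X : ptopologicalType) :=
  PointedTopological.on (Prob R X).

Definition nz_finite_measure (R : realType) (X : ptopologicalType) : Type :=
  {mu : {finite_measure set borel X -> \bar R} | mu setT <> 0%E}.

HB.instance Definition _ (R : realType) (X : ptopologicalType) :=
  gen_eqMixin (nz_finite_measure R X).
HB.instance Definition _ (R : realType) (X : ptopologicalType) :=
  gen_choiceMixin (nz_finite_measure R X).

Definition Meas (R : realType) (X : ptopologicalType) : Type :=
  initial_topology
    (fun mu : nz_finite_measure R X => @narrow_eval R X (sval mu)).

HB.instance Definition _ (R : realType) (X : ptopologicalType) :=
  Topological.on (Meas R X).

(* Iterated Lebesgue integral; for a nonnegative Borel [F] it is the integral
   of [F] against n-dimensional Lebesgue measure, by Tonelli. *)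
Fixpoint lebesgue_iter (R : realType) (n : nat) :
    (n.-tuple R -> \bar R) -> \bar R :=
  match n with
  | 0 => fun F => F [tuple]
  | m.+1 => fun F =>
      (\int[lebesgue_measure]_x
        lebesgue_iter (fun y : m.-tuple R => F [tuple of x :: y]))%E
  end.

Definition simplex (R : realType) (k : nat) : set (k.-tuple R) :=
  [set y | (forall i, 0 <= tnth y i) /\ \sum_i tnth y i = 1].

Definition dirichlet_density (R : realType) (k : nat) (alpha : 'I_k -> R)
    (y : k.-tuple R) : R :=
  gamma (\sum_i alpha i) / (\prod_i gamma (alpha i)) *
  \prod_i (tnth y i `^ (alpha i - 1)).

(* The last coordinate is [1 - (z_1 + ... + z_n)]; for [n = 0] there is nothing
   to integrate and this is the Dirac mass at 1. *)
Definition dirichlet (R : realType) (n : nat) (alpha : 'I_n.+1 -> R)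
    (B : set (n.+1.-tuple R)) : \bar R :=
  lebesgue_iter (fun z : n.-tuple R =>
    let y := [tuple of rcons z (1 - \sum_i tnth z i)] in
    (\1_(B `&` @simplex R n.+1) y * dirichlet_density alpha y)%:E).

Definition borel_partition (X : ptopologicalType) (k : nat)
    (A : 'I_k -> set (borel X)) : Prop :=
  [/\ forall i, measurable (A i), trivIset setT A & \bigcup_i A i = setT].

Definition masses (R : realType) (X : ptopologicalType) (k : nat)
    (A : 'I_k -> set (borel X)) (eta : Prob R X) : k.-tuple R :=
  [tuple fine (eta (A i)) | i < k].

(* The second conjunct follows from the first as soon as some Borel set [A] has
   [nu A > 0] and [nu (~` A) > 0]: move [N] from one side of the partition
   [A, ~` A] to the other and compare means.  If there is no such [A] (on a
   second countable Hausdorff space: if [nu] is carried by one point [x]), the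
   first conjunct only says that [eta setT = 1], and the second one singles out
   the Dirac mass at the Dirac mass at [x]. *)
Definition dirichlet_ferguson (R : realType) (X : ptopologicalType)
    (nu : {measure set borel X -> \bar R}) (D : Prob R (Prob R X)) : Prop :=
  (forall (n : nat) (A : 'I_n.+1 -> set (borel X)),
     borel_partition A -> (forall i, (0 < nu (A i))%E) ->
     forall B : set (n.+1.-tuple R), measurable B ->
       pushforward D (masses A) B =
       dirichlet (fun i => fine (nu (A i))) B) /\
  (forall N : set (borel X), measurable N -> nu N = 0%E ->
     {ae D, forall eta : Prob R X, eta N = 0%E}).

(* Main.v *)
Require Import Defs.
From HB Require Import structures.
From mathcomp Require Import all_boot all_order all_algebra all_fingroup.
From mathcomp Require Import all_classical all_reals all_analysis.
From mathcomp Require Import measurable_realfun.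
From mathcomp Require Import complex ring lra.

Set Implicit Arguments.
Unset Strict Implicit.
Unset Printing Implicit Defensive.
Import Order.TTheory GRing.Theory Num.Theory.
Import numFieldNormedType.Exports.
Local Open Scope classical_set_scope.
Local Open Scope ring_scope.

(** Both claims rest on one formula, [mixed_moment]: if [b] is the total mass of
    [nu] and [f_0, ..., f_(n-1)] are bounded and continuous, then
      [b (b + 1) ... (b + n - 1) * E prod_i int f_i d eta]
    is the sum, over the permutations [s] of the indices, of the product over
    the cycles [c] of [s] of [int prod_(j in c) f_j d nu].

    The formula comes from the urn behind the Dirichlet law.  By parts in a Beta
    integral, the masses [y_c] of the blocks of a partition satisfy
      [(nu_c + m_c) E(y_d y^m) = (nu_d + m_d) E(y_c y^m)]
    ([dirichlet_exchange], [fibre_exchange]).  As the masses add up to 1, summing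
    over [c] gives
      [(b + |m|) E(y_d y^m) = (nu_d + m_d) E(y^m)].
    Hence, for functions that are constant on the blocks, multiplying in one more
    function either contributes its own integral or merges it with one of the
    functions already present ([urn_recursion]).  Sums over permutations obey the
    same recursion, since one more point is either fixed or inserted in a cycle
    after one of the other points ([sum_cycles_recl]).  Blocks of mass zero, on
    which the Dirichlet law says nothing, are absorbed into another block
    ([quantized_moment]), and continuous functions are uniform limits of finitely
    valued ones ([quantization]).

    When all the [f_i] are equal, the right-hand side is [n!] times the cycle
    index, and the characteristic function is the sum of the exponential series
    under the integral ([characteristic_function]).

    For the continuity in the intensity, the formula shows that the expectation
    of a polynomial in finitely many functionals [eta |-> int f d eta] is a
    continuous function of [nu]: it is a polynomial in integrals against [nu]
    divided by a product of positive factors.  The functions [f] being arbitrary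
    and [X] possibly non-compact, polynomials do not approximate every bounded
    continuous function of [eta], but they are enough.  Uniform limits of
    polynomials form a lattice, and that lattice contains a countable family
    of functions between 0 and 1 by which the indicator of every open set of
    probability measures is exhausted from below.  Such a family controls narrow
    convergence by a layer-cake argument ([narrow_cvg_of_exhausting]).  The
    family is obtained in two rounds, on [X] from complete regularity and second
    countability, and then on the space of probability measures, where the first
    round supplies a countable basis ([cylinder_separating]). *)

(** * Permutations of [n.+1] points *)

Section InsertPoint.
Local Open Scope group_scope.
Variable n : nat.
Implicit Types (s : 'S_n) (j : 'I_n.+1) (i k : 'I_n).

(** For [j = ord0] the new point is fixed; for [j = lift ord0 i] it is inserted
    right after [i] in the cycle of [i]. *)
Definition insert_perm j s : 'S_n.+1 :=
  tperm ord0 j * lift_perm ord0 ord0 s.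

Lemma insert_perm_lift j s k :
  lift ord0 k != j -> insert_perm j s (lift ord0 k) = lift ord0 (s k).
Proof.
move=> kj; rewrite permM tpermD ?lift_perm_lift//; last by rewrite eq_sym.
Qed.

Lemma insert_permj j s : insert_perm j s j = ord0.
Proof. by rewrite permM tpermR lift_perm_id. Qed.

Lemma insert_perm0 i s : insert_perm (lift ord0 i) s ord0 = lift ord0 (s i).
Proof. by rewrite permM tpermL lift_perm_lift. Qed.

Lemma insert_perm_bij :
  bijective (fun js : 'I_n.+1 * 'S_n => insert_perm js.1 js.2).
Proof.
apply: inj_card_bij; last first.
  by rewrite card_prod card_ord !card_Sn factS.
move=> [j s] [j' s'] /= e.
have ejj' : j = j'.
  apply: (@perm_inj _ (insert_perm j s)).
  by rewrite insert_permj e insert_permj.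
rewrite ejj' in e *; congr pair; move/mulgI: e => e.
apply/permP => k; apply: (@lift_inj _ ord0).
by rewrite -!(lift_perm_lift ord0) e.
Qed.

Definition lift_set (c : {set 'I_n}) : {set 'I_n.+1} := (lift ord0 @: c)%SET.

Definition insert_set i (c : {set 'I_n}) : {set 'I_n.+1} :=
  if i \in c then (ord0 |: lift_set c)%SET else lift_set c.

Let retract i j : 'I_n := odflt i (unlift ord0 j).

Lemma retractK i k : retract i (lift ord0 k) = k.
Proof. by rewrite /retract liftK. Qed.

Lemma mem_lift_set c k : (lift ord0 k \in lift_set c) = (k \in c).
Proof. exact/mem_imset/lift_inj. Qed.

Lemma mem0_lift_set c : (ord0 \in lift_set c) = false.
Proof. by apply/imsetP => -[k _ /eqP]; rewrite (negPf (neq_lift _ _)). Qed.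

Lemma insert_setE i c : insert_set i c = (retract i @^-1: c)%SET.
Proof.
apply/setP => j; rewrite !inE /insert_set.
case: (unliftP ord0 j) => [k ->|->].
  rewrite retractK; case: ifP => _; rewrite ?inE mem_lift_set//.
rewrite /retract unlift_none/=; case: ifP => _; first by rewrite !inE eqxx.
exact: mem0_lift_set.
Qed.

Lemma insert_set_inj i : injective (insert_set i).
Proof.
move=> c d; rewrite !insert_setE => /setP e; apply/setP => k.
by have := e (lift ord0 k); rewrite !inE retractK.
Qed.

(** The map [retract i] sends the new point to the point [i] that precedes it in
    its cycle.  It maps orbits into orbits, and one step of [s] is one or two
    steps of the enlarged permutation, so the new orbits are the preimages of
    the old ones. *)
Lemma porbit_insert i s j :
  porbit (insert_perm (lift ord0 i) s) j = insert_set i (porbit s (retract i j)).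
Proof.
set t := insert_perm _ s.
have step x : porbit s (retract i (t x)) = porbit s (retract i x).
  apply/eqP; rewrite eq_porbit_mem; case: (unliftP ord0 x) => [k ->|->].
    have [/eqP->|ki] := boolP (lift ord0 k == lift ord0 i).
      by rewrite insert_permj /retract unlift_none liftK porbit_id.
    by rewrite insert_perm_lift// !retractK (mem_porbit s 1).
  by rewrite insert_perm0 retractK /retract unlift_none (mem_porbit s 1).
have sub x y : y \in porbit t x -> porbit s (retract i y) = porbit s (retract i x).
  move=> /porbitP[m ->]; elim: m => [|m IH]; first by rewrite expg0 perm1.
  by rewrite expgSr permM step.
have sym x y : (x \in porbit t y) = (y \in porbit t x) by rewrite porbit_sym.
have tr x y z : y \in porbit t x -> z \in porbit t y -> z \in porbit t x.
  by rewrite -!eq_porbit_mem => /eqP <- .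
have tx x : t x \in porbit t x by rewrite (mem_porbit t 1).
have lift_step k : lift ord0 (s k) \in porbit t (lift ord0 k).
  have [/eqP ki|ki] := boolP (lift ord0 k == lift ord0 i).
    have -> : lift ord0 (s k) = t (t (lift ord0 k)).
      by rewrite ki insert_permj insert_perm0 (lift_inj ki).
    exact: tr (tx _) (tx _).
  by rewrite -(insert_perm_lift s ki).
have lift_sub k m : lift ord0 ((s ^+ m) k) \in porbit t (lift ord0 k).
  elim: m => [|m IH]; first by rewrite expg0 perm1 porbit_id.
  by rewrite expgSr permM; apply: tr IH (lift_step _).
have lift_retract x : lift ord0 (retract i x) \in porbit t x.
  case: (unliftP ord0 x) => [k ->|->]; first by rewrite retractK porbit_id.
  rewrite /retract unlift_none/= sym.
  by have := tx (lift ord0 i); rewrite insert_permj.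
apply/setP => y; rewrite insert_setE inE; apply/idP/idP => [yj|].
  by rewrite -eq_porbit_mem (sub _ _ yj).
move=> /porbitP[m e].
have h := lift_sub (retract i j) m; rewrite -e in h.
by apply: tr (lift_retract j) (tr _ _ _ h _); rewrite sym.
Qed.

Lemma porbits_insert i s :
  porbits (insert_perm (lift ord0 i) s) = (insert_set i @: porbits s)%SET.
Proof.
apply/setP => c; apply/imsetP/imsetP => [[j _ ->]|[d /imsetP[k _ ->] ->]].
  by exists (porbit s (retract i j)); rewrite ?imset_f ?porbit_insert.
by exists (lift ord0 k) => //; rewrite porbit_insert retractK.
Qed.

Lemma porbits_insert0 s :
  porbits (insert_perm ord0 s) = ([set ord0] |: (lift_set @: porbits s))%SET.
Proof.
set t := insert_perm ord0 s.
have t0 : t ord0 = ord0 by rewrite insert_permj.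
have tk k : t (lift ord0 k) = lift ord0 (s k).
  by rewrite insert_perm_lift // eq_sym neq_lift.
clearbody t.
have tm0 m : (t ^+ m) ord0 = ord0.
  by elim: m => [|m IH]; rewrite ?expg0 ?perm1// expgSr permM IH.
have tmk m k : (t ^+ m) (lift ord0 k) = lift ord0 ((s ^+ m) k).
  by elim: m => [|m IH]; rewrite ?expg0 ?perm1// !expgSr !permM IH tk.
have p0 : porbit t ord0 = [set ord0]%SET.
  apply/setP => y; rewrite inE; apply/porbitP/eqP => [[m ->//]|->].
  by exists 0%N; rewrite expg0 perm1.
have pk k : porbit t (lift ord0 k) = lift_set (porbit s k).
  apply/setP => y; apply/porbitP/imsetP => [[m ->]|[x /porbitP[m ->] ->]].
    by exists ((s ^+ m) k); rewrite ?mem_porbit// tmk.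
  by exists m; rewrite tmk.
apply/setP => c; rewrite !inE; apply/imsetP/orP => [[j _ ->]|[/eqP->|]].
- case: (unliftP ord0 j) => [k ->|->]; last by left; rewrite p0.
  by right; rewrite pk; apply/imset_f/imset_f.
- by exists ord0.
- by move=> /imsetP[d /imsetP[k _ ->] ->]; exists (lift ord0 k).
Qed.

Lemma lift_set_inj : injective lift_set.
Proof.
by move=> c d /setP e; apply/setP => k; have := e (lift ord0 k); rewrite !mem_lift_set.
Qed.

End InsertPoint.

(** Each permutation of [n.+1] points arises exactly once by adding the point
    [ord0] to a permutation of [n] points. *)
Lemma sum_cycles_recl (R : comPzRingType) n (w : {set 'I_n.+1} -> R) :
  \sum_(s : 'S_n.+1) \prod_(c in porbits s) w c =
  w [set ord0]%SET * (\sum_(s : 'S_n) \prod_(c in porbits s) w (lift_set c)) +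
  \sum_(i < n) \sum_(s : 'S_n) \prod_(c in porbits s) w (insert_set i c).
Proof.
rewrite (reindex _ (onW_bij _ (insert_perm_bij n)))/=.
rewrite -(pair_bigA _ (fun j s => \prod_(c in porbits (insert_perm j s)) w c))/=.
rewrite big_ord_recl mulr_sumr; congr (_ + _); apply: eq_bigr => s _.
  rewrite porbits_insert0 big_setU1/=; last first.
    apply/imsetP => -[c _ /setP/(_ ord0)]; rewrite mem0_lift_set.
    by rewrite inE eqxx.
  by rewrite big_imset//= => c d _ _; apply: lift_set_inj.
apply: eq_bigr => t _.
by rewrite porbits_insert big_imset//= => c d _ _; apply: insert_set_inj.
Qed.

Lemma cycle_index_porbits (R : realType) n (t : nat -> R) :
  cycle_index n t = (n`!%:R)^-1 * \sum_(s : 'S_n) \prod_(c in porbits s) t #|c|.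
Proof.
congr (_ * _); apply: eq_bigr => s _.
have cb (c : {set 'I_n}) : c \in porbits s -> (0 < #|c| < n.+1)%N.
  move=> /imsetP[x _ ->]; rewrite lt0n card_porbit_neq0/= ltnS.
  by rewrite -[leqRHS]card_ord max_card.
rewrite (eq_bigr (fun i => \prod_(c in porbits s | #|c| == i) t #|c|)); last first.
  move=> i _; rewrite (eq_bigr (fun=> t i)); last by move=> c /andP[_ /eqP->].
  by rewrite prodr_const /ncycles; congr (_ ^+ _); apply: eq_card => c; rewrite inE.
rewrite big_nat_cond.
transitivity (\prod_(i < n.+1) \prod_(c in porbits s | #|c| == i) t #|c|).
  rewrite -(big_mkord xpredT (fun i => \prod_(c in porbits s | #|c| == i) t #|c|)).
  rewrite [RHS]big_ltn// [X in _ = X * _]big_pred0 ?mul1r; last first.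
    by move=> c; apply/negP => /andP[cs /eqP c0]; have := cb c cs; rewrite c0.
  by rewrite [RHS]big_nat_cond.
rewrite [RHS](partition_big (fun c : {set 'I_n} => inord #|c| : 'I_n.+1) xpredT)//=.
apply: eq_bigr => i _; apply: eq_bigl => c; case: (boolP (_ \in _)) => //= cs.
by rewrite -val_eqE/= inordK//; case/andP: (cb _ cs).
Qed.

(** * Beta and Gamma integrals by parts *)

Section ByParts.
Variable R : realType.
Local Notation mu := (@lebesgue_measure R).

(** On the compact intervals the two integrals differ by a boundary term, which
    vanishes in the limit.  Working in [\bar R] spares any proof that the
    integrals are finite. *)
Lemma ge0_integral_balance (I : set R) (s t : R ^nat) (F u v : R -> R) :
  \bigcup_k `[s k, t k]%classic = I ->
  (forall k, s k < t k) ->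
  nondecreasing_seq (fun k => `[s k, t k]%classic) ->
  (forall k x, x \in `[s k, t k] ->
     [/\ is_derive x 1 F (u x - v x), {for x, continuous u},
         {for x, continuous v}, 0 <= u x & 0 <= v x]) ->
  F (t k) - F (s k) @[k --> \oo] --> 0 ->
  (\int[mu]_(x in I) (u x)%:E = \int[mu]_(x in I) (v x)%:E)%E.
Proof.
move=> <- st nd H F0.
have cu k : {within `[s k, t k], continuous u}.
  by apply: continuous_in_subspaceT => x /set_mem/= /H[].
have cv k : {within `[s k, t k], continuous v}.
  by apply: continuous_in_subspaceT => x /set_mem/= /H[].
have iu k : mu.-integrable `[s k, t k] (EFin \o u).
  by apply: continuous_compact_integrable => //; exact: segment_compact.
have iv k : mu.-integrable `[s k, t k] (EFin \o v).
  by apply: continuous_compact_integrable => //; exact: segment_compact.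
have E k : (\int[mu]_(x in `[s k, t k]) (u x)%:E =
    \int[mu]_(x in `[s k, t k]) (v x)%:E + (F (t k) - F (s k))%:E)%E.
  have cF x : x \in `[s k, t k] -> {for x, continuous F}.
    move=> /H[[dF _] _ _ _ _].
    by apply: differentiable_continuous; apply/derivable1_diffP.
  have := @continuous_FTC2 R (fun x => u x - v x) F (s k) (t k) (st k).
  rewrite -EFinB => <-; last 3 first.
  - by apply: continuous_in_subspaceT => x /set_mem/= /H[_ ? ? _ _]; apply: cvgB.
  - split.
    + by move=> x xst; have [[]] := H k x (subset_itv_oo_cc xst).
    + apply: cvg_at_right_filter; apply: cF.
      by rewrite in_itv/= lexx ltW.
    + apply: cvg_at_left_filter; apply: cF.
      by rewrite in_itv/= lexx ltW.
  - move=> x xst; have [[_ <-]] := H k x (subset_itv_oo_cc xst).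
    by rewrite derive1E.
  under [X in (_ = _ + X)%E]eq_integral do rewrite EFinB.
  rewrite integralB//= addeCA subee ?adde0//.
  exact: integrable_fin_num.
have L (f : R -> R) : (forall k, mu.-integrable `[s k, t k] (EFin \o f)) ->
    (forall k x, x \in `[s k, t k] -> 0 <= f x) ->
    (\int[mu]_(x in `[s k, t k]) (f x)%:E @[k --> \oo] -->
     \int[mu]_(x in \bigcup_k `[s k, t k]%classic) (f x)%:E)%E.
  move=> if_ f0; apply: ge0_nondecreasing_set_cvg_integral => //.
  by move=> k; exact: (measurable_int mu (if_ k)).
have Lu := L u iu (fun k x xk => let: And5 _ _ _ p _ := H k x xk in p).
have Lv := L v iv (fun k x xk => let: And5 _ _ _ _ p := H k x xk in p).
rewrite -(cvg_lim _ Lu)//; apply/cvg_lim => //.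
rewrite -[X in _ --> X]adde0.
rewrite (_ : (fun i => _) =
   (fun k => \int[mu]_(x in `[s k, t k]) (v x)%:E + (F (t k) - F (s k))%:E)%E).
  apply: cvgeD => //; first by rewrite fin_num_adde_defl.
  by apply: cvg_EFin; [exact: nearW|].
by apply/funext => k; exact: E.
Qed.

(** Integrating the derivative of [x^a (r - x)^b] over [[0, r]]. *)
Lemma beta_integral_balance (r a b : R) : 0 < r -> 0 < a -> 0 < b ->
  (\int[mu]_(x in `]0%R, r[) (a * x `^ (a - 1) * (r - x) `^ b)%:E =
   \int[mu]_(x in `]0%R, r[) (b * x `^ a * (r - x) `^ (b - 1))%:E)%E.
Proof.
move=> r0 a0 b0.
pose s (k : nat) : R := r / k.+3%:R.
pose t (k : nat) : R := r - s k.
have s0 k : 0 < s k by rewrite divr_gt0.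
have sr k : s k + s k < r.
  rewrite -mulrDr -[ltRHS]mulr1 ltr_pM2l// -mulr2n -[ltLHS]mulr_natl ltr_pdivrMr//.
  by rewrite mul1r ltr_nat.
have cs : s k @[k --> \oo] --> (0 : R).
  rewrite -(mulr0 r); apply: cvgM; first exact: cvg_cst.
  have := @cvg_harmonic R; rewrite -(cvg_shiftn 2)/=.
  by apply: cvg_trans; apply: near_eq_cvg; near=> k; rewrite /= addn2.
have U : \bigcup_k `[s k, t k]%classic = `]0%R, r[%classic.
  apply/seteqP; split => [x [k _]/=|x/=]; rewrite !in_itv/= => /andP[h1 h2].
    rewrite (lt_le_trans (s0 k) h1)/= (le_lt_trans h2)// ltrBlDr ltrDl.
    exact: s0.
  have m0 : 0 < Num.min x (r - x) by rewrite lt_min h1 subr_gt0.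
  have : \forall k \near \oo, s k < Num.min x (r - x) by exact: (cvgr_lt 0).
  move=> [k _ /(_ k (leqnn k))/=]; rewrite lt_min => /andP[k1 k2].
  exists k => //=; rewrite in_itv/= ltW//= lerBrDl -lerBrDr; exact: ltW.
have cp (c : R) : 0 < c -> (s k) `^ c @[k --> \oo] --> (0 : R).
  move=> c0; have /cvg_at_rightP := powR_cvg0 c0; apply; split => //.
have m (x c : R) : 0 <= x <= r -> 0 < c -> 0 <= x `^ c <= r `^ c.
  move=> /andP[x0 xr] c0; rewrite powR_ge0/= ge0_ler_powR// ?nnegrE//; exact: ltW.
apply: (@ge0_integral_balance _ s t (fun x => x `^ a * (r - x) `^ b)
   (fun x => a * x `^ (a - 1) * (r - x) `^ b)
   (fun x => b * x `^ a * (r - x) `^ (b - 1)) U).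
- by move=> k; rewrite ltrBrDr.
- move=> k l kl; rewrite subsetEset; apply: subset_itv; rewrite bnd_simp.
    by rewrite ler_pM2l// lef_pV2 ?posrE// ler_nat.
  by rewrite lerB// ler_pM2l// lef_pV2 ?posrE// ler_nat.
- move=> k x xk.
  have : x \in `]0, r[.
    have : (\bigcup_k `[s k, t k]%classic) x by exists k.
    by rewrite U.
  rewrite in_itv/= => /andP[x0 xr].
  have rx0 : 0 < r - x by rewrite subr_gt0.
  have dr (y : R) : is_derive y 1 (fun x => r - x) (-1 : R).
    have := is_deriveB (is_derive_cst r y (1 : R)) (is_derive_id y (1 : R)).
    by rewrite sub0r.
  have d2 (c : R) : is_derive x 1 (fun x => (r - x) `^ c) (- (c * (r - x) `^ (c - 1))).
    have := @is_derive1_comp R (fun y => y `^ c) (fun x => r - x) x _ _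
      (is_derive1_powR c rx0) (dr x).
    by rewrite mulrN1.
  have c1 (c : R) : {for x, continuous (fun x => x `^ c)}.
    apply: differentiable_continuous; apply/derivable1_diffP.
    by case: (is_derive1_powR c x0).
  have c2 (c : R) : {for x, continuous (fun x => (r - x) `^ c)}.
    apply: differentiable_continuous; apply/derivable1_diffP.
    by case: (d2 c).
  split.
  + apply: (is_derive_eq (is_deriveM (is_derive1_powR a x0) (d2 b))).
    by rewrite /GRing.scale/=; ring.
  + by apply: cvgM (c2 b); apply: cvgM (c1 _); exact: cvg_cst.
  + by apply: cvgM (c2 _); apply: cvgM (c1 _); exact: cvg_cst.
  + by rewrite !mulr_ge0 ?powR_ge0// ltW.
  + by rewrite !mulr_ge0 ?powR_ge0// ltW.
- have sI k : 0 <= s k <= r.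
    by rewrite ltW//= ltW// (lt_trans _ (sr k))// ltrDl.
  have tI k : 0 <= t k <= r.
    by have /andP[? ?] := sI k; rewrite subr_ge0 lerBlDr lerDl; apply/andP.
  rewrite -(subrr (0 : R)); apply: cvgB.
  + apply: (@squeeze_cvgr _ _ _ _ (fun=> 0) (fun k => r `^ a * s k `^ b)).
    * near=> k; rewrite mulr_ge0 ?powR_ge0//= opprB addrCA subrr addr0.
      by rewrite ler_wpM2r ?powR_ge0//; case/andP: (m _ _ (tI k) a0).
    * exact: cvg_cst.
    * by rewrite -(mulr0 (r `^ a)); apply: cvgM (cp _ b0); exact: cvg_cst.
  + apply: (@squeeze_cvgr _ _ _ _ (fun=> 0) (fun k => s k `^ a * r `^ b)).
    * near=> k; rewrite mulr_ge0 ?powR_ge0//=.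
      by rewrite ler_wpM2l ?powR_ge0//; case/andP: (m _ _ (tI k) b0).
    * exact: cvg_cst.
    * by rewrite -(mul0r (r `^ b)); apply: cvgM (cp _ a0) _; exact: cvg_cst.
Unshelve. all: by end_near. Qed.

(** Integrating the derivative of [x^a exp(-x)] over the half-line. *)
Lemma gamma_integral_balance (a : R) : 0 < a ->
  (\int[mu]_(x in `]0%R, +oo[) (a * (x `^ (a - 1) * expR (- x)))%:E =
   \int[mu]_(x in `]0%R, +oo[) (x `^ (a + 1 - 1) * expR (- x))%:E)%E.
Proof.
move=> a0; rewrite addrK.
pose s (k : nat) : R := k.+2%:R^-1.
pose t (k : nat) : R := k.+2%:R.
have s0 k : 0 < s k by rewrite invr_gt0.
have cs : s k @[k --> \oo] --> (0 : R).
  have := @cvg_harmonic R; rewrite -(cvg_shiftn 1)/=.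
  by apply: cvg_trans; apply: near_eq_cvg; near=> k; rewrite /= addn1.
have U : \bigcup_k `[s k, t k]%classic = `]0%R, +oo[%classic.
  apply/seteqP; split => [x [k _]/=|x/=]; rewrite !in_itv/= andbT.
    by move=> /andP[h1 h2]; rewrite (lt_le_trans (s0 k) h1).
  move=> x0.
  have : \forall k \near \oo, s k < x by exact: (cvgr_lt 0).
  move=> [k _ /(_ _ (leq_addr (Num.truncn x) k))/= kx].
  exists (k + Num.truncn x)%N => //=; rewrite in_itv/= ltW//= ltW//.
  rewrite (lt_le_trans (truncnS_gt x))// ler_nat ltnS ltnW// ltnS.
  exact: leq_addl.
apply: (@ge0_integral_balance _ s t (fun x => x `^ a * expR (- x))
   (fun x => a * (x `^ (a - 1) * expR (- x)))
   (fun x => x `^ a * expR (- x)) U).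
- by move=> k; apply: (@lt_trans _ _ 1); rewrite /s/t ?ltr1n// invf_lt1 ?ltr0n// ltr1n.
- move=> k l kl; rewrite subsetEset; apply: subset_itv; rewrite bnd_simp.
    by rewrite lef_pV2 ?posrE// ler_nat.
  by rewrite ler_nat.
- move=> k x; rewrite in_itv/= => /andP[/(lt_le_trans (s0 k)) x0 _].
  have de : is_derive x 1 (fun x => expR (- x)) (- expR (- x)).
    have := @is_derive1_comp R expR (fun x => - x) x _ _
      (is_derive_expR _) (is_deriveN (is_derive_id x 1)).
    by rewrite mulrN1.
  have c1 (c : R) : {for x, continuous (fun x => x `^ c)}.
    apply: differentiable_continuous; apply/derivable1_diffP.
    by case: (is_derive1_powR c x0).
  have c2 : {for x, continuous (fun x => expR (- x))}.
    apply: differentiable_continuous; apply/derivable1_diffP.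
    by case: de.
  split.
  + apply: (is_derive_eq (is_deriveM (is_derive1_powR a x0) de)).
    by rewrite /GRing.scale/=; ring.
  + by apply: cvgM; [exact: cvg_cst|apply: cvgM (c1 _) c2].
  + by apply: cvgM (c1 _) c2.
  + by rewrite !mulr_ge0 ?powR_ge0 ?expR_ge0// ltW.
  + by rewrite !mulr_ge0 ?powR_ge0 ?expR_ge0.
- rewrite -(subrr (0 : R)); apply: cvgB.
  + pose n := (Num.truncn a).+1.
    apply: (@squeeze_cvgr _ _ _ _ (fun=> 0) (fun k => n.+1`!%:R * s k)).
    (* [t^a exp(-t) <= n.+1`! / t] since [t^a <= t^n] and [t^n.+1 / n.+1`! <= exp t] *)
    * near=> k; rewrite mulr_ge0 ?powR_ge0 ?expR_ge0//=.
      rewrite expRN ler_pdivrMr ?expR_gt0//.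
      apply: (@le_trans _ _ (t k ^+ n)).
        rewrite -powR_mulrn; last exact: ler0n.
        by rewrite ler_powR// ?ler1n// ltW// truncnS_gt.
      have tk : 0 < t k by rewrite ltr0n.
      rewrite mulrAC [leRHS](_ : _ = n.+1`!%:R * expR (t k) / t k)//.
      rewrite ler_pdivlMr// -exprSr [leRHS]mulrC -ler_pdivrMr ?ltr0n ?fact_gt0//.
      by have := expR_ge1Dxn n (ltW tk); apply: le_trans; rewrite lerDr.
    * exact: cvg_cst.
    * by rewrite -(mulr0 n.+1`!%:R); apply: cvgM cs; exact: cvg_cst.
  + apply: (@squeeze_cvgr _ _ _ _ (fun=> 0) (fun k => s k `^ a)).
    * near=> k; rewrite mulr_ge0 ?powR_ge0 ?expR_ge0//=.
      by rewrite -[leRHS]mulr1 ler_wpM2l ?powR_ge0// expRN invf_le1 ?expR_gt0// -[leLHS]expR0 ler_expR ltW.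
    * exact: cvg_cst.
    * have /cvg_at_rightP := powR_cvg0 a0; apply; split => //.
Unshelve. all: by end_near. Qed.

Lemma gamma_ge0 (a : R) : 0 <= gamma a.
Proof.
by apply: Rintegral_ge0 => x _; rewrite mulr_ge0 ?powR_ge0 ?expR_ge0.
Qed.

Lemma measurable_gamma_integrand (a : R) (D : set R) : measurable D ->
  measurable_fun D (fun x => (x `^ (a - 1) * expR (- x))%:E).
Proof.
move=> mD; apply/measurable_EFinP; apply: measurable_funM.
  by apply: measurable_funTS; exact: measurable_powR.
by apply: measurableT_comp.
Qed.

Lemma gammaD1 (a : R) : 0 < a -> gamma (a + 1) = a * gamma a.
Proof.
move=> a0; rewrite /gamma /Rintegral -gamma_integral_balance//.
have -> : (\int[mu]_(x in `]0%R, +oo[) (a * (x `^ (a - 1) * expR (- x)))%:E =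
    a%:E * \int[mu]_(x in `]0%R, +oo[) (x `^ (a - 1) * expR (- x))%:E)%E.
  rewrite -ge0_integralZl//=.
  - exact: measurable_gamma_integrand.
  - by move=> x _; rewrite lee_fin mulr_ge0 ?powR_ge0 ?expR_ge0.
  - by rewrite lee_fin ltW.
(* if the integral is infinite, both sides are 0 *)
set I := (\int[_]_(x in _) _)%E.
case: I => [r| |] //=; first by rewrite gt0_muley ?lte_fin// mulr0.
by rewrite gt0_muleNy ?lte_fin// mulr0.
Qed.

Lemma risingE (b : R) n : 0 < b -> gamma b != 0 ->
  rising b n = \prod_(k < n) (b + k%:R).
Proof.
move=> b0 gb; elim: n => [|n IH].
  by rewrite big_ord0 /rising addr0 divff.
rewrite big_ord_recr/= -IH /rising -natr1 addrA gammaD1 ?ltr_wpDr//.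
by ring.
Qed.

End ByParts.

(** * Iterated Lebesgue integrals *)

Section LebesgueIter.
Variable R : realType.
Local Open Scope ereal_scope.
Local Notation mu := (@lebesgue_measure R).

Lemma lebesgue_iter_ge0 n (F : n.-tuple R -> \bar R) :
  (forall y, 0 <= F y) -> 0 <= lebesgue_iter F.
Proof.
elim: n F => [|n IH] F F0 /=; first exact: F0.
by apply: integral_ge0 => x _; apply: IH.
Qed.

Lemma measurable_cons_pair d (T : measurableType d) n :
  measurable_fun [set: T * R * n.-tuple R]
    (fun p : T * R * n.-tuple R => (p.1.1, [tuple of p.1.2 :: p.2])).
Proof.
apply: measurable_fun_pair.
  exact: (measurableT_comp measurable_fst measurable_fst).
apply: measurable_cons; last exact: measurable_snd.
exact: (measurableT_comp measurable_snd measurable_fst).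
Qed.

(** The parameter in an arbitrary [T] is what makes the induction work: each
    integration variable in turn becomes part of the parameter. *)
Lemma measurable_lebesgue_iter n d (T : measurableType d)
    (F : T * n.-tuple R -> \bar R) :
  measurable_fun setT F -> (forall p, 0 <= F p) ->
  measurable_fun setT (fun t => lebesgue_iter (fun y => F (t, y))).
Proof.
elim: n d T F => [|n IH] d T F mF F0 /=.
  apply: (@measurableT_comp _ _ _ _ _ _ F _ (fun t => (t, [tuple]))) => //.
apply: (@measurable_fun_fubini_tonelli_F _ _ T (measurableTypeR R) R mu
  (fun p => lebesgue_iter (fun y => F (p.1, [tuple of p.2 :: y])))).
- apply: (IH _ _ (fun q : (T * R) * n.-tuple R =>
    F (q.1.1, [tuple of q.1.2 :: q.2]))) => //.
  exact: (measurableT_comp mF (@measurable_cons_pair _ T n)).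
- by move=> p; apply: lebesgue_iter_ge0.
Qed.

Lemma measurable_tuple_cons n (x : R) :
  measurable_fun [set: n.-tuple R] (fun y : n.-tuple R => [tuple of x :: y]).
Proof. by apply: measurable_cons; [exact: measurable_cst|exact: measurable_id]. Qed.

Lemma measurable_consF n (F : n.+1.-tuple R -> \bar R) (x : R) :
  measurable_fun setT F ->
  measurable_fun setT (fun y : n.-tuple R => F [tuple of x :: y]).
Proof.
by move=> mF; exact: (measurableT_comp mF (@measurable_tuple_cons n x)).
Qed.

Lemma measurable_lebesgue_iter_cons n (F : n.+1.-tuple R -> \bar R) :
  measurable_fun setT F -> (forall p, 0 <= F p) ->
  measurable_fun setT (fun x : R => lebesgue_iter (fun y => F [tuple of x :: y])).
Proof.
move=> mF F0.
apply: (@measurable_lebesgue_iter n _ R (fun q => F [tuple of q.1 :: q.2])) => //.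
have mc : measurable_fun [set: R * n.-tuple R]
    (fun q : R * n.-tuple R => [tuple of q.1 :: q.2]).
  exact: measurable_cons measurable_fst measurable_snd.
exact: measurableT_comp mF mc.
Qed.

Lemma le_lebesgue_iter n (F G : n.-tuple R -> \bar R) :
  measurable_fun setT F -> measurable_fun setT G ->
  (forall y, 0 <= F y) -> (forall y, F y <= G y) ->
  lebesgue_iter F <= lebesgue_iter G.
Proof.
elim: n F G => [|n IH] F G mF mG F0 FG /=; first exact: FG.
have G0 y : 0 <= G y by apply: le_trans (FG y).
apply: ge0_le_integral => //.
- by move=> x _; apply: lebesgue_iter_ge0.
- exact: measurable_lebesgue_iter_cons.
- exact: measurable_lebesgue_iter_cons.
- by move=> x _; apply: IH => //; exact: measurable_consF.
Qed.

Lemma lebesgue_iterD n (F G : n.-tuple R -> \bar R) :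
  measurable_fun setT F -> measurable_fun setT G ->
  (forall y, 0 <= F y) -> (forall y, 0 <= G y) ->
  lebesgue_iter (fun y => F y + G y) = lebesgue_iter F + lebesgue_iter G.
Proof.
elim: n F G => [//|n IH] F G mF mG F0 G0 /=.
rewrite -ge0_integralD//; last 4 first.
- by move=> x _; apply: lebesgue_iter_ge0.
- exact: measurable_lebesgue_iter_cons.
- by move=> x _; apply: lebesgue_iter_ge0.
- exact: measurable_lebesgue_iter_cons.
by apply: eq_integral => x _; apply: IH => //; exact: measurable_consF.
Qed.

Lemma lebesgue_iterZl n (c : R) (F : n.-tuple R -> \bar R) : (0 <= c)%R ->
  measurable_fun setT F -> (forall y, 0 <= F y) ->
  lebesgue_iter (fun y => c%:E * F y) = c%:E * lebesgue_iter F.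
Proof.
move=> c0; elim: n F => [//|n IH] F mF F0 /=.
rewrite -ge0_integralZl//; last 2 first.
- exact: measurable_lebesgue_iter_cons.
- by move=> x _; apply: lebesgue_iter_ge0.
by apply: eq_integral => x _; apply: IH => //; exact: measurable_consF.
Qed.

Lemma eq_lebesgue_iter n (F G : n.-tuple R -> \bar R) :
  F =1 G -> lebesgue_iter F = lebesgue_iter G.
Proof. by move=> /funext ->. Qed.

Lemma lebesgue_iter0 n : lebesgue_iter (fun _ : n.-tuple R => 0) = 0 :> \bar R.
Proof. by elim: n => //= n IH; rewrite integral0_eq. Qed.

Lemma cvg_lebesgue_iter n (F : (n.-tuple R -> \bar R)^nat) (G : n.-tuple R -> \bar R) :
  (forall k, measurable_fun setT (F k)) -> (forall k y, 0 <= F k y) ->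
  (forall y, nondecreasing_seq (F ^~ y)) -> (forall y, F ^~ y @ \oo --> G y) ->
  lebesgue_iter (F k) @[k --> \oo] --> lebesgue_iter G.
Proof.
elim: n F G => [|n IH] F G mF F0 ndF FG /=; first exact: FG.
pose f k x := lebesgue_iter (fun y => F k [tuple of x :: y]).
have cf x : f k x @[k --> \oo] --> lebesgue_iter (fun y => G [tuple of x :: y]).
  apply: IH => // k; exact: measurable_consF.
rewrite (_ : (fun x => lebesgue_iter _) = fun x => limn (f^~ x)); last first.
  by apply/funext => x; apply/esym/cvg_lim.
apply: cvg_monotone_convergence => //.
- by move=> k; apply: measurable_lebesgue_iter_cons.
- by move=> k x _; apply: lebesgue_iter_ge0.
- move=> x _ k l kl; apply: le_lebesgue_iter => //; last by move=> y; apply: ndF.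
    exact: measurable_consF.
  exact: measurable_consF.
Qed.

End LebesgueIter.

Section Transfer.
Context (R : realType) (n : nat).
Local Open Scope ereal_scope.
Import HBNNSimple.

Lemma lebesgue_iter_sum (I : Type) (s : seq I) (F : I -> n.-tuple R -> \bar R) :
  (forall i, measurable_fun setT (F i)) -> (forall i y, 0 <= F i y) ->
  lebesgue_iter (fun y => \sum_(i <- s) F i y) =
  \sum_(i <- s) lebesgue_iter (F i).
Proof.
move=> mF F0; elim: s => [|i s IH].
  under eq_lebesgue_iter do rewrite big_nil.
  by rewrite big_nil lebesgue_iter0.
under eq_lebesgue_iter do rewrite big_cons.
rewrite big_cons lebesgue_iterD// ?IH//.
- exact: emeasurable_sum.
- by move=> y; apply: sume_ge0.
Qed.

(** The law of [phi] is given on sets only; the integral of [g] follows through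
    simple functions and monotone limits. *)
Lemma integral_lebesgue_iter d d' (S : measurableType d) (T : measurableType d')
    (D : {measure set S -> \bar R}) (phi : S -> T)
    (y : n.-tuple R -> T) (w : n.-tuple R -> R) :
  measurable_fun setT phi -> measurable_fun setT y -> measurable_fun setT w ->
  (forall z, 0 <= w z)%R ->
  (forall B, measurable B ->
    D (phi @^-1` B) = lebesgue_iter (fun z => (\1_B (y z) * w z)%:E)) ->
  forall g : T -> R, measurable_fun setT g -> (forall t, 0 <= g t)%R ->
  \int[D]_s (g (phi s))%:E = lebesgue_iter (fun z => (g (y z) * w z)%:E).
Proof.
move=> mphi my mw w0 DE g mg g0.
have mB B : measurable B -> measurable_fun setT (fun z => (\1_B (y z) * w z)%:E).
  move=> mB; apply/measurable_EFinP; apply: measurable_funM => //.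
  by apply: measurableT_comp my; exact: measurable_indic.
have simple (h : {nnsfun T >-> R}) :
    \int[D]_s (h (phi s))%:E = lebesgue_iter (fun z => (h (y z) * w z)%:E).
  pose s : seq R := finmap.enum_fset (fset_set (range h)).
  have hE t : h t = (\sum_(r <- s) r * \1_(h @^-1` [set r]) t)%R.
    by rewrite [LHS]fimfunE fsbig_finite.
  have rI r t : (0 <= r * \1_(h @^-1` [set r]) t)%R.
    have [r0|r0] := leP 0%R r; first by rewrite mulr_ge0.
    by rewrite preimage_nnfun0// indic0 mulr0.
  have mphi' B : measurable B -> measurable (phi @^-1` B).
    by move=> mB'; rewrite -[X in measurable X]setTI; exact: mphi.
  transitivity (\sum_(r <- s) r%:E * D (phi @^-1` (h @^-1` [set r]))).
    transitivity (\int[D]_x \sum_(r <- s) (r * \1_(phi @^-1` (h @^-1` [set r])) x)%:E).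
      by apply: eq_integral => x _; rewrite hE sumEFin.
    rewrite ge0_integral_sum//; last 2 first.
    - move=> r; apply/measurable_EFinP/measurable_funM => //.
      by apply: measurable_indic; exact: mphi'.
    - by move=> r x _; rewrite lee_fin; exact: (rI r (phi x)).
    apply: eq_bigr => r _.
    rewrite (integralZl_indic _ (fun r => phi @^-1` (h @^-1` [set r])))//.
    - by rewrite integral_indic// ?setIT//; exact: mphi'.
    - by move=> r0; rewrite preimage_nnfun0// preimage_set0.
    - exact: mphi'.
  transitivity (\sum_(r <- s) lebesgue_iter
      (fun z => (r * \1_(h @^-1` [set r]) (y z) * w z)%:E)).
    apply: eq_bigr => r _; have [r0|r0] := leP 0%R r.
      rewrite DE// -lebesgue_iterZl//; [|exact: mB|]; last first.
        by move=> z; rewrite lee_fin mulr_ge0.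
      by apply: eq_lebesgue_iter => z; rewrite -EFinM mulrA.
    rewrite preimage_nnfun0// preimage_set0 measure0 mule0.
    rewrite (eq_lebesgue_iter (G := fun=> 0)) ?lebesgue_iter0// => z.
    by rewrite indic0 mulr0 mul0r.
  rewrite -lebesgue_iter_sum//.
  - by apply: eq_lebesgue_iter => z; rewrite sumEFin hE mulr_suml.
  - move=> r; under eq_fun do rewrite -mulrA EFinM.
    by apply: measurable_funeM; exact: mB.
  - by move=> r z; rewrite lee_fin mulr_ge0.
have mg' : measurable_fun setT (EFin \o g) by apply/measurable_EFinP.
pose h := nnsfun_approx measurableT mg'.
have hcvg t : (h k t)%:E @[k --> \oo] --> (g t)%:E.
  by apply: (cvg_nnsfun_approx measurableT mg') => // x _; rewrite lee_fin.
have hnd t : nondecreasing_seq (h ^~ t).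
  by move=> k l kl; exact/lefP/nd_nnsfun_approx.
have L1 : \int[D]_s (h k (phi s))%:E @[k --> \oo] --> \int[D]_s (g (phi s))%:E.
  rewrite (_ : (fun s => (g (phi s))%:E) =
      fun s => limn (fun k => (h k (phi s))%:E)); last first.
    by apply/funext => s; apply/esym/cvg_lim.
  apply: cvg_monotone_convergence => //.
  - by move=> k; apply/measurable_EFinP; exact: measurableT_comp.
  - by move=> k x _; rewrite lee_fin.
  - by move=> x _ k l kl; rewrite lee_fin; exact: hnd.
have L2 : lebesgue_iter (fun z => (h k (y z) * w z)%:E) @[k --> \oo] -->
    lebesgue_iter (fun z => (g (y z) * w z)%:E).
  apply: cvg_lebesgue_iter.
  - move=> k; apply/measurable_EFinP; apply: measurable_funM => //.
    exact: measurableT_comp.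
  - by move=> k z; rewrite lee_fin mulr_ge0.
  - by move=> z k l kl; rewrite lee_fin ler_wpM2r//; exact: hnd.
  - move=> z; under eq_fun do rewrite EFinM.
    by rewrite EFinM; apply: cvgeM => //; exact: cvg_cst.
rewrite -(cvg_lim _ L1)// -(cvg_lim _ L2)//.
by congr (limn _); apply/funext => k; exact: simple.
Qed.

End Transfer.

(** * Moments of the Dirichlet law *)

Section DirichletExchange.
Variable R : realType.
Local Notation mu := (@lebesgue_measure R).

(** The last coordinate is the one that is integrated first. *)
Lemma lebesgue_iter_inner n (F G : n.+1.-tuple R -> \bar R) :
  (forall x : n.-tuple R,
    \int[mu]_u F [tuple of rcons x u] = \int[mu]_u G [tuple of rcons x u])%E ->
  lebesgue_iter F = lebesgue_iter G.
Proof.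
elim: n F G => [|n IH] F G FG.
  have e (u : R) : [tuple of rcons [tuple] u] = [tuple of u :: [tuple]].
    exact: val_inj.
  have := FG [tuple]; under eq_integral do rewrite e.
  by under [X in _ = X -> _]eq_integral do rewrite e.
apply: eq_integral => x0 _.
apply: (IH (fun y => F [tuple of x0 :: y]) (fun y => G [tuple of x0 :: y])) => x.
have e (u : R) : [tuple of rcons [tuple of x0 :: x] u] =
    [tuple of x0 :: [tuple of rcons x u]] by exact: val_inj.
have := FG [tuple of x0 :: x]; under eq_integral do rewrite e.
by under [X in _ = X -> _]eq_integral do rewrite e.
Qed.

Lemma tnth_rcons_last k (t : k.-tuple R) v (i : 'I_k.+1) :
  val i = k -> tnth [tuple of rcons t v] i = v.
Proof. by move=> ik; rewrite (tnth_nth 0)/= ik nth_rcons size_tuple ltnn eqxx. Qed.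

Lemma tnth_rcons_lt k (t : k.-tuple R) v (i : 'I_k.+1) (l : 'I_k) :
  val i = val l -> tnth [tuple of rcons t v] i = tnth t l.
Proof.
by move=> il; rewrite !(tnth_nth 0)/= il nth_rcons size_tuple ltn_ord.
Qed.

Lemma integral_itv_support (r : R) (f g : R -> \bar R) :
  (forall u, ~ (0 <= u <= r) -> f u = 0%E) ->
  (forall u, 0 < u < r -> f u = g u) -> measurable_fun `]0%R, r[ g ->
  (\int[mu]_u f u = \int[mu]_(u in `]0%R, r[) g u)%E.
Proof.
move=> f0 fg mg.
have fgI : {in `]0%R, r[%classic, f =1 g}.
  by move=> u; rewrite inE/= in_itv/= => /fg.
transitivity (\int[mu]_(u in `[0%R, r]) f u)%E.
  rewrite [RHS]integral_mkcond; apply: eq_integral => u _.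
  rewrite patchE; case: ifPn => // /negP ur; apply: f0 => ur'; apply: ur.
  by rewrite inE/= in_itv.
rewrite integral_itv_bndoo; last first.
  by apply: eq_measurable_fun mg => u /fgI.
by apply: eq_integral => u /fgI.
Qed.

(** With all coordinates but the last two frozen, these are [u] and [r - u], and
    the integrands are the same multiple of the two sides of
    [beta_integral_balance] for the exponents [alpha i + m i] and
    [alpha j + m j]. *)
Lemma dirichlet_exchange n (alpha : 'I_n.+2 -> R) (m : 'I_n.+2 -> nat)
    (i j : 'I_n.+2) : val i = n -> val j = n.+1 -> (forall k, 0 < alpha k) ->
  let y (z : n.+1.-tuple R) : n.+2.-tuple R :=
    [tuple of rcons z (1 - \sum_k tnth z k)] in
  let w z := \1_(@simplex R n.+2) (y z) * dirichlet_density alpha (y z) in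
  lebesgue_iter (fun z : n.+1.-tuple R =>
    ((alpha i + (m i)%:R) * (tnth (y z) j * \prod_k tnth (y z) k ^+ m k) * w z)%:E) =
  lebesgue_iter (fun z : n.+1.-tuple R =>
    ((alpha j + (m j)%:R) * (tnth (y z) i * \prod_k tnth (y z) k ^+ m k) * w z)%:E).
Proof.
move=> iE jE alpha0 y w; apply: lebesgue_iter_inner => x.
pose r := 1 - \sum_k tnth x k.
pose a := alpha i + (m i)%:R.
pose b := alpha j + (m j)%:R.
have a0 : 0 < a by rewrite ltr_wpDr.
have b0 : 0 < b by rewrite ltr_wpDr.
pose i' : 'I_n.+2 := widen_ord (leqnSn n.+1) ord_max.
have ii' : i' = i by apply: val_inj.
have jj' : ord_max = j by apply: val_inj.
pose wi (k : 'I_n) : 'I_n.+2 := widen_ord (leqnSn n.+1) (widen_ord (leqnSn n) k).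
pose K := gamma (\sum_k alpha k) / (\prod_k gamma (alpha k)) *
  \prod_(k < n) (tnth x k `^ (alpha (wi k) - 1) * tnth x k ^+ m (wi k)).
have K0 : (forall k, 0 <= tnth x k) -> 0 <= K.
  move=> x0; rewrite mulr_ge0//.
    by rewrite divr_ge0 ?gamma_ge0// prodr_ge0// => k _; rewrite gamma_ge0.
  by rewrite prodr_ge0// => k _; rewrite mulr_ge0 ?powR_ge0 ?exprn_ge0.
have yi u : tnth (y [tuple of rcons x u]) i = u.
  by rewrite (tnth_rcons_lt _ _ (l := ord_max)) ?tnth_rcons_last.
have sE u : 1 - \sum_k tnth [tuple of rcons x u] k = r - u.
  rewrite /r -addrA -opprD; congr (1 - _).
  rewrite big_ord_recr; congr (_ + _); last by rewrite tnth_rcons_last.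
  by apply: eq_bigr => k _; rewrite (tnth_rcons_lt _ _ (l := k)).
have yj u : tnth (y [tuple of rcons x u]) j = r - u.
  by rewrite tnth_rcons_last ?sE.
have yw u k : tnth (y [tuple of rcons x u]) (wi k) = tnth x k.
  rewrite (tnth_rcons_lt _ _ (l := widen_ord (leqnSn n) k))//.
  by rewrite (tnth_rcons_lt _ _ (l := k)).
have cases (k : 'I_n.+2) : [\/ k = i, k = j | exists l, k = wi l].
  have := ltn_ord k; rewrite ltnS leq_eqVlt => /predU1P[kj|].
    by constructor 2; apply: val_inj; exact: etrans kj (esym jE).
  rewrite ltnS leq_eqVlt => /predU1P[ki|kn].
    by constructor 1; apply: val_inj; exact: etrans ki (esym iE).
  by constructor 3; exists (Ordinal kn); apply: val_inj.
have simplexE u : simplex (y [tuple of rcons x u]) <->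
    (forall k, 0 <= tnth x k) /\ 0 <= u <= r.
  split => [[y0 _]|[x0 /andP[u0 ur]]].
    split; first by move=> k; rewrite -(yw u).
    by rewrite -{1}(yi u) y0/= -subr_ge0 -yj y0.
  split.
    move=> k; have [->|->|[l ->]] := cases k; rewrite ?yi ?yj ?yw//.
    by rewrite subr_ge0.
  rewrite 2!big_ord_recr/= -/i' ii' jj' yi yj.
  rewrite (eq_bigr (tnth x)); last by move=> k _; rewrite -[RHS](yw u).
  by rewrite /r; ring.
have prod2 (f : 'I_n.+2 -> R) : \prod_k f k = \prod_(k < n) f (wi k) * f i * f j.
  by rewrite 2!big_ord_recr/= -/i' ii' jj'.
pose f1 u := a * u `^ (a - 1) * (r - u) `^ b.
pose f2 u := b * u `^ a * (r - u) `^ (b - 1).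
have mp (c d : R) : measurable_fun setT (fun u : R => u `^ c * (r - u) `^ d).
  apply: measurable_funM; first exact: measurable_powR.
  have mr : measurable_fun setT (fun u : R => r - u) by exact: measurable_funB.
  exact: (measurableT_comp (measurable_powR d) mr).
have mf1 : measurable_fun setT f1.
  have -> : f1 = fun u => a * (u `^ (a - 1) * (r - u) `^ b).
    by apply/funext => u; rewrite /f1 mulrA.
  by apply: measurable_funM; [exact: measurable_cst|exact: mp].
have mf2 : measurable_fun setT f2.
  have -> : f2 = fun u => b * (u `^ a * (r - u) `^ (b - 1)).
    by apply/funext => u; rewrite /f2 mulrA.
  by apply: measurable_funM; [exact: measurable_cst|exact: mp].
have f10 u : 0 <= f1 u by rewrite !mulr_ge0 ?powR_ge0// ltW.
have f20 u : 0 <= f2 u by rewrite !mulr_ge0 ?powR_ge0// ltW.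
have pow (c : R) k u : 0 < u -> u ^+ k * u `^ c = u `^ (c + k%:R).
  move=> u0; rewrite powRD; last by apply/implyP => _; rewrite gt_eqF.
  by rewrite powR_mulrn 1?mulrC// ltW.
have wout u : ~ ((forall k, 0 <= tnth x k) /\ 0 <= u <= r) ->
    w [tuple of rcons x u] = 0.
  by move=> h; rewrite /w indicE memNset ?mul0r//; apply: contra_not h => /simplexE.
have win u : (forall k, 0 <= tnth x k) -> 0 < u < r ->
    (\prod_k tnth (y [tuple of rcons x u]) k ^+ m k) * w [tuple of rcons x u] =
    K * (u `^ (a - 1) * (r - u) `^ (b - 1)).
  move=> x0 /andP[u0 ur]; have ru0 : 0 < r - u by rewrite subr_gt0.
  rewrite /w indicE mem_set ?mul1r; last by apply/simplexE; split; rewrite ?ltW.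
  rewrite /dirichlet_density !prod2 yi yj.
  have -> : \prod_(k < n) tnth (y [tuple of rcons x u]) (wi k) ^+ m (wi k) =
      \prod_(k < n) tnth x k ^+ m (wi k) by apply: eq_bigr => k _; rewrite yw.
  have -> : \prod_(k < n) tnth (y [tuple of rcons x u]) (wi k) `^ (alpha (wi k) - 1) =
      \prod_(k < n) tnth x k `^ (alpha (wi k) - 1) by apply: eq_bigr => k _; rewrite yw.
  have ea : a - 1 = (alpha i - 1) + (m i)%:R by rewrite /a; ring.
  have eb : b - 1 = (alpha j - 1) + (m j)%:R by rewrite /b; ring.
  rewrite ea eb -!pow//.
  by rewrite /K big_split/= -(prod2 (fun k => gamma (alpha k))); ring.
have [x0|nx0] := pselect (forall k, 0 <= tnth x k); last first.
  by rewrite !integral0_eq// => u _; rewrite wout ?mulr0// => -[].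
have out c (h : n.+2.-tuple R -> R) u : ~ (0 <= u <= r) ->
    (c * h (y [tuple of rcons x u]) * w [tuple of rcons x u])%:E = 0%E.
  by move=> ur; rewrite wout ?mulr0// => -[].
have IK (f : R -> R) : measurable_fun setT f -> (forall u : R, 0 <= f u) ->
    (\int[mu]_(u in `]0%R, r[) (K%:E * (f u)%:E) =
     K%:E * \int[mu]_(u in `]0%R, r[) (f u)%:E)%E.
  move=> mf f0; rewrite ge0_integralZl//.
  - by apply/measurable_EFinP/measurable_funTS.
  - by move=> u _; rewrite lee_fin.
  - by rewrite lee_fin K0.
rewrite (@integral_itv_support r _ (fun u => K%:E * (f1 u)%:E)%E).
- rewrite (@integral_itv_support r _ (fun u => K%:E * (f2 u)%:E)%E).
  + rewrite !IK//; congr (_ * _)%E.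
    have [r0|r0] := ltP 0 r; first exact: beta_integral_balance.
    by rewrite !set_itv_ge ?integral_set0// bnd_simp -leNgt.
  + move=> u ur.
    exact: (out _ (fun y : n.+2.-tuple R => tnth y i * \prod_k tnth y k ^+ m k) u ur).
  + move=> u ur; rewrite -mulrA -mulrA win// yi -EFinM; congr EFin.
    case/andP: ur => u0 ur; rewrite /f2; have := pow (a - 1) 1%N u u0; rewrite subrK expr1 => <-.
    by rewrite -/b; ring.
  + by apply: emeasurable_funM => //; apply/measurable_EFinP/measurable_funTS.
- move=> u ur.
  exact: (out _ (fun y : n.+2.-tuple R => tnth y j * \prod_k tnth y k ^+ m k) u ur).
- move=> u ur; rewrite -mulrA -mulrA win// yj -EFinM; congr EFin.
  case/andP: ur => u0; rewrite -subr_gt0 => ru0.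
  have := pow (b - 1) 1%N _ ru0; rewrite subrK expr1 /f1 => <-.
  by rewrite -/a; ring.
- by apply: emeasurable_funM => //; apply/measurable_EFinP/measurable_funTS.
Qed.

End DirichletExchange.

(** * Bounded measurable functions *)

Section BoundedMeasurable.
Context d (T : measurableType d) (R : realType).
Implicit Types f g : T -> R.

Definition bounded_measurable f :=
  measurable_fun setT f /\ exists M : R, forall x, `|f x| <= M.

Lemma bounded_measurable_cst (c : R) : bounded_measurable (fun=> c).
Proof. by split; [exact: measurable_cst|exists `|c|]. Qed.

Lemma bounded_measurableD f g : bounded_measurable f -> bounded_measurable g ->
  bounded_measurable (fun x => f x + g x).
Proof.
move=> [mf [M fM]] [mg [N gN]]; split; first exact: measurable_funD.
by exists (M + N) => x; rewrite (le_trans (ler_normD _ _))// lerD.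
Qed.

Lemma bounded_measurableM f g : bounded_measurable f -> bounded_measurable g ->
  bounded_measurable (fun x => f x * g x).
Proof.
move=> [mf [M fM]] [mg [N gN]]; split; first exact: measurable_funM.
by exists (M * N) => x; rewrite normrM ler_pM.
Qed.

Lemma bounded_measurableX f n : bounded_measurable f ->
  bounded_measurable (fun x => f x ^+ n).
Proof.
move=> bf; elim: n => [|n IH].
  by under eq_fun do rewrite expr0; exact: bounded_measurable_cst.
by under eq_fun do rewrite exprS; exact: bounded_measurableM.
Qed.

Lemma bounded_measurable_sum I (s : seq I) (P : pred I) (F : I -> T -> R) :
  (forall i, bounded_measurable (F i)) ->
  bounded_measurable (fun x => \sum_(i <- s | P i) F i x).
Proof.
move=> bF; elim: s => [|i s IH].
  by under eq_fun do rewrite big_nil; exact: bounded_measurable_cst.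
under eq_fun do rewrite big_cons; case: (P i) => //.
exact: bounded_measurableD.
Qed.

Lemma bounded_measurable_prod I (s : seq I) (P : pred I) (F : I -> T -> R) :
  (forall i, bounded_measurable (F i)) ->
  bounded_measurable (fun x => \prod_(i <- s | P i) F i x).
Proof.
move=> bF; elim: s => [|i s IH].
  by under eq_fun do rewrite big_nil; exact: bounded_measurable_cst.
under eq_fun do rewrite big_cons; case: (P i) => //.
exact: bounded_measurableM.
Qed.

Lemma bounded_measurable_indic (A : set T) : measurable A ->
  bounded_measurable (\1_A : T -> R).
Proof.
move=> mA; split; first exact: measurable_indic.
by exists 1 => x; rewrite indicE; case: (_ \in _); rewrite ?normr1 ?normr0.
Qed.

Section FiniteMeasure.
Variable mu : {measure set T -> \bar R}.
Hypothesis mufin : (mu setT < +oo)%E.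

Lemma bounded_measurable_integrable f :
  bounded_measurable f -> mu.-integrable setT (EFin \o f).
Proof.
move=> [mf [M fM]]; apply: measurable_bounded_integrable => //.
exists M; split; first exact: num_real.
by move=> N /ltW MN x _; apply: le_trans MN; exact: fM.
Qed.
Local Notation bmi := bounded_measurable_integrable.

Lemma bounded_RintegralZl c f : bounded_measurable f ->
  \int[mu]_x (c * f x) = c * \int[mu]_x f x.
Proof. by move=> bf; rewrite RintegralZl//; exact: bmi. Qed.

Lemma bounded_RintegralD f g : bounded_measurable f -> bounded_measurable g ->
  \int[mu]_x (f x + g x) = \int[mu]_x f x + \int[mu]_x g x.
Proof. by move=> bf bg; rewrite RintegralD//; exact: bmi. Qed.

Lemma bounded_Rintegral_sum I (s : seq I) (P : pred I) (F : I -> T -> R) :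
  (forall i, bounded_measurable (F i)) ->
  \int[mu]_x (\sum_(i <- s | P i) F i x) = \sum_(i <- s | P i) \int[mu]_x F i x.
Proof.
move=> bF; elim: s => [|i s IH].
  under eq_Rintegral do rewrite big_nil.
  by rewrite big_nil Rintegral_cst// mul0r.
under eq_Rintegral do rewrite big_cons.
rewrite big_cons -IH; case: (P i) => //.
by rewrite bounded_RintegralD//; exact: bounded_measurable_sum.
Qed.

Lemma le_bounded_Rintegral f g : bounded_measurable f -> bounded_measurable g ->
  (forall x, f x <= g x) -> \int[mu]_x f x <= \int[mu]_x g x.
Proof. by move=> bf bg fg; apply: le_Rintegral => //; exact: bmi. Qed.

Lemma Rintegral_indicT (A : set T) : measurable A ->
  \int[mu]_x (\1_A x) = fine (mu A).
Proof. by move=> mA; rewrite /Rintegral integral_indic// setIT. Qed.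

Lemma bounded_cvg_Rintegral (h : nat -> T -> R) f (M : R) :
  (forall k, measurable_fun setT (h k)) -> (forall k x, `|h k x| <= M) ->
  (forall x, h k x @[k --> \oo] --> f x) ->
  \int[mu]_x h k x @[k --> \oo] --> \int[mu]_x f x.
Proof.
move=> mh hM hf.
have mf : measurable_fun setT f by apply: (measurable_fun_cvg (h := h)).
have bf : bounded_measurable f.
  split => //; exists M => x; have cn : `|h k x| @[k --> \oo] --> `|f x|.
    by apply: cvg_norm; exact: hf.
  rewrite -(cvg_lim _ cn)//; apply: limr_le; first exact: cvgP cn.
  exact: nearW.
have hint k : mu.-integrable setT (EFin \o h k).
  by apply: bmi; split => //; exists M.
have cvgE : (\int[mu]_x (h k x)%:E @[k --> \oo] --> \int[mu]_x (f x)%:E)%E.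
  have [|||||_ _] := @dominated_convergence _ _ R mu setT measurableT
    (fun k x => (h k x)%:E) (fun x => (f x)%:E) (cst M%:E) => //.
  - by move=> k; apply/measurable_EFinP.
  - exact/measurable_EFinP.
  - apply: aeW => x _; apply: cvg_EFin; last exact: hf.
    by apply: nearW => k.
  - by apply: bmi; exact: bounded_measurable_cst.
  - by apply: aeW => x k _; rewrite lee_fin.
apply: fine_cvg; rewrite fineK//; apply: integrable_fin_num => //; exact: bmi.
Qed.

End FiniteMeasure.
End BoundedMeasurable.

(** * Continuous functions and Borel sets *)
Section ContinuousFun.
Variables (R : realType) (T : topologicalType).
Implicit Types f g : T -> R.

Lemma continuous_funmin f g : continuous f -> continuous g ->
  continuous (fun x => Num.min (f x) (g x)).
Proof. by move=> cf cg x; exact: (@continuous_min R T f g x (cf x) (cg x)). Qed.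

Lemma continuous_funmax f g : continuous f -> continuous g ->
  continuous (fun x => Num.max (f x) (g x)).
Proof. by move=> cf cg x; exact: (@continuous_max R T f g x (cf x) (cg x)). Qed.

Lemma continuous_fun_cst (c : R) : continuous (fun _ : T => c).
Proof. by move=> x; exact: cvg_cst. Qed.

Lemma continuous_funD f g : continuous f -> continuous g ->
  continuous (fun x => f x + g x).
Proof. by move=> cf cg x; apply: cvgD; [exact: cf|exact: cg]. Qed.

Lemma continuous_funB f g : continuous f -> continuous g ->
  continuous (fun x => f x - g x).
Proof. by move=> cf cg x; apply: cvgB; [exact: cf|exact: cg]. Qed.

Lemma continuous_funM f g : continuous f -> continuous g ->
  continuous (fun x => f x * g x).
Proof. by move=> cf cg x; apply: cvgM; [exact: cf|exact: cg]. Qed.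

End ContinuousFun.

Section Borel.
Variables (R : realType) (X : ptopologicalType).
Implicit Types (f g : X -> R) (A : set X).

Lemma open_borel_measurable A : open A -> measurable (A : set (borel X)).
Proof. by move=> oA; exact: sub_sigma_algebra. Qed.

Lemma continuous_borel_measurable f : continuous f ->
  measurable_fun setT (f : borel X -> R).
Proof.
move=> /continuousP cf; apply: (measurability _ (RGenOpens.measurableE R)).
move=> _ [_ [a [b ->] <-]]; rewrite setTI; apply: open_borel_measurable.
exact/cf/interval_open.
Qed.

End Borel.

Section ContinuityLimitSet.
Variables (R : realType) (X : ptopologicalType).
Implicit Types (f g : X -> R) (A : set X).

(** The mass of such a set is a pointwise limit of narrowly continuous functions
    of the measure, so it is a Borel function of the measure on any topological
    space. *)
Definition continuity_limit_set A := exists h : nat -> X -> R,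
  [/\ forall k, continuous (h k), exists M : R, forall k x, `|h k x| <= M &
      forall x, h k x @[k --> \oo] --> (\1_A x : R)].

Lemma continuity_limit_setC A :
  continuity_limit_set A -> continuity_limit_set (~` A).
Proof.
move=> [h [ch [M hM] hA]]; exists (fun k x => 1 - h k x); split.
- by move=> k x; apply: cvgB; [exact: cvg_cst|exact: ch].
- by exists (1 + M) => k x; rewrite (le_trans (ler_normB _ _))// normr1 lerD2l.
- move=> x; rewrite (_ : \1_(~` A) x = 1 - \1_A x).
    by apply: cvgB; [exact: cvg_cst|exact: hA].
  by rewrite !indicE in_setC; case: (_ \in _); rewrite ?subrr ?subr0.
Qed.

Lemma continuity_limit_setI A B : continuity_limit_set A ->
  continuity_limit_set B -> continuity_limit_set (A `&` B).
Proof.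
move=> [h [ch [M hM] hA]] [g [cg [N gN] gB]].
exists (fun k x => h k x * g k x); split.
- by move=> k x; apply: cvgM; [exact: ch|exact: cg].
- by exists (M * N) => k x; rewrite normrM ler_pM.
- by move=> x; rewrite indicI; apply: cvgM; [exact: hA|exact: gB].
Qed.

Lemma continuity_limit_set0 : continuity_limit_set set0.
Proof.
exists (fun _ _ => 0); split => [k x||x]; first exact: cvg_cst.
  by exists 0 => k x; rewrite normr0.
by rewrite indic0; exact: cvg_cst.
Qed.

Lemma continuity_limit_setU A B : continuity_limit_set A ->
  continuity_limit_set B -> continuity_limit_set (A `|` B).
Proof.
move=> hA hB; rewrite -(setCK (A `|` B)) setCU.
by apply: continuity_limit_setC; apply: continuity_limit_setI; exact: continuity_limit_setC.
Qed.

Lemma continuity_limit_set_bigcap (I : eqType) (s : seq I) (F : I -> set X) :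
  (forall i, i \in s -> continuity_limit_set (F i)) ->
  continuity_limit_set (\bigcap_(i in [set` s]) F i).
Proof.
elim: s => [|i s IH] hF.
  have -> : [set` [::]] = set0 :> set I by apply/seteqP; split => j.
  by rewrite bigcap_set0 -setC0; apply: continuity_limit_setC; exact: continuity_limit_set0.
have -> : [set` i :: s] = i |` [set` s].
  apply/seteqP; split => j /=; rewrite inE; first by move=> /predU1P.
  by move=> [->|->]; rewrite ?eqxx ?orbT.
rewrite bigcap_setU1; apply: continuity_limit_setI.
  by apply: hF; rewrite inE eqxx.
by apply: IH => j js; apply: hF; rewrite inE js orbT.
Qed.

Lemma continuity_limit_set_bigcup (I : eqType) (s : seq I) (F : I -> set X) :
  (forall i, i \in s -> continuity_limit_set (F i)) ->
  continuity_limit_set (\bigcup_(i in [set` s]) F i).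
Proof.
move=> hF; rewrite -(setCK (\bigcup_(i in _) _)) setC_bigcup.
apply: continuity_limit_setC; apply: continuity_limit_set_bigcap => i /hF.
exact: continuity_limit_setC.
Qed.

(** The functions [min 1 (k (f - c)^+)] increase to the indicator of [f > c]. *)
Lemma continuity_limit_set_gt f (c : R) : continuous f ->
  continuity_limit_set [set x | c < f x].
Proof.
move=> cf.
exists (fun k x => Num.min 1 (k%:R * Num.max 0 (f x - c))); split.
- move=> k; apply: continuous_funmin; first exact: continuous_fun_cst.
  apply: continuous_funM; first exact: continuous_fun_cst.
  apply: continuous_funmax; first exact: continuous_fun_cst.
  by apply: continuous_funB => //; exact: continuous_fun_cst.
- exists 1 => k x; rewrite ger0_norm ?ge_min ?lexx//.
  by rewrite le_min ler01/= mulr_ge0// le_max lexx.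
- move=> x; rewrite indicE; have [cx|cx] := ltP c (f x).
    rewrite mem_set//=; have fc0 : 0 < f x - c by rewrite subr_gt0.
    apply: cvg_near_cst; near=> k.
    rewrite max_r ?(ltW fc0)//; apply/eqP; rewrite eq_minl -ler_pdivrMr//.
    near: k; exact: nbhs_infty_ger.
  rewrite memNset//=; last by apply/negP; rewrite -leNgt.
  rewrite max_l ?subr_le0//; under eq_fun do rewrite mulr0 min_r ?ler01//.
  exact: cvg_cst.
Unshelve. all: by end_near. Qed.

Lemma continuity_limit_set_measurable A : continuity_limit_set A ->
  measurable (A : set (borel X)).
Proof.
move=> [h [ch _ hA]].
have mA : measurable_fun setT (\1_A : borel X -> R).
  apply: (measurable_fun_cvg (h := fun k => (h k : borel X -> R))) => //.
  by move=> k; exact: continuous_borel_measurable.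
have : measurable ((\1_A : borel X -> R) @^-1` [set 1]).
  by rewrite -[X in measurable X]setTI; exact: mA.
congr (measurable _); apply/seteqP; split => x /=; rewrite indicE.
  by move/eqP; rewrite pnatr_eq1 eqb1 inE.
by move=> Ax; rewrite mem_set.
Qed.

Lemma integral_eval_continuous f : continuous f ->
  (exists M : R, forall x, `|f x| <= M) ->
  continuous (fun eta : Prob R X => \int[eta]_x f x).
Proof.
move=> cf bf eta.
pose F : bounded_continuous R X := exist _ f (conj cf bf).
have c1 := @initial_continuous _ _ (fun mu : probability (borel X) R => @narrow_eval R X mu).
exact: (continuous_comp (c1 eta) (@proj_continuous _ (fun _ : bounded_continuous R X => R) F _)).
Qed.

Lemma mass_measurable A : continuity_limit_set A ->
  measurable_fun setT (fun eta : borel (Prob R X) => fine ((eta : Prob R X) A)).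
Proof.
move=> cA; have [h [ch [M hM] hA]] := cA.
apply: (measurable_fun_cvg (h := fun k (eta : borel (Prob R X)) =>
  \int[(eta : Prob R X)]_x h k x)).
  move=> k; apply: (@continuous_borel_measurable R (Prob R X)
    (fun eta => \int[eta]_x h k x)).
  by apply: integral_eval_continuous => //; exists M.
move=> eta _; rewrite -Rintegral_indicT; last exact: continuity_limit_set_measurable.
apply: (@bounded_cvg_Rintegral _ (borel X) R (eta : Prob R X) _ h _ M) => //.
  by rewrite [X in (X < _)%E]probability_setT ltry.
by move=> k; exact: continuous_borel_measurable.
Qed.

End ContinuityLimitSet.

(** * Masses of the blocks of a Borel partition *)

Section DirichletMeasurability.
Variables (R : realType) (n : nat).

Lemma measurable_simplex : measurable (@simplex R n).
Proof.
rewrite (_ : @simplex R n = (\bigcap_(i in [set: 'I_n]) [set y : n.-tuple R | 0 <= tnth y i])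
   `&` [set y | \sum_i tnth y i = 1]); last first.
  apply/seteqP; split => y /= [y0 y1]; split => // i; last exact: y0.
  by move=> _; exact: y0.
apply: measurableI.
  apply: fin_bigcap_measurable => [|i _]; first exact: finite_finset.
  have mt : measurable_fun [set: n.-tuple R] (fun y => tnth y i).
    exact: measurable_tnth.
  have := mt measurableT `[0, +oo[%classic (measurable_itv _).
  rewrite setTI; congr (measurable _).
  by apply/seteqP; split => x /=; rewrite in_itv/= andbT.
rewrite -[X in measurable X]setTI.
have ms : measurable_fun [set: n.-tuple R] (fun y => \sum_i tnth y i).
  by apply: measurable_sum => i; exact: measurable_tnth.
exact: (ms measurableT [set 1]).
Qed.

Lemma measurable_dirichlet_density (alpha : 'I_n -> R) :
  measurable_fun setT (dirichlet_density alpha).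
Proof.
apply: measurable_funM; first exact: measurable_cst.
apply: measurable_prod => i _.
exact: (measurableT_comp (measurable_powR _) (measurable_tnth i)).
Qed.

Lemma measurable_rcons_compl :
  measurable_fun setT (fun z : n.-tuple R =>
    [tuple of rcons z (1 - \sum_i tnth z i)] : n.+1.-tuple R).
Proof.
apply/measurable_fun_tnthP => i.
have [in_|ni] := ltnP i n.
  rewrite (_ : _ \o _ = fun z : n.-tuple R => tnth z (Ordinal in_)).
    exact: measurable_tnth.
  by apply/funext => z /=; rewrite (tnth_rcons_lt _ _ (l := Ordinal in_)).
rewrite (_ : _ \o _ = fun z : n.-tuple R => 1 - \sum_i tnth z i).
  apply: measurable_funB => //.
  by apply: measurable_sum => k; exact: measurable_tnth.
apply/funext => z /=; rewrite tnth_rcons_last//.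
by apply/eqP; rewrite eqn_leq ni -ltnS ltn_ord.
Qed.

End DirichletMeasurability.

Lemma dirichlet_density_ge0 (R : realType) n (alpha : 'I_n -> R) (y : n.-tuple R) :
  0 <= dirichlet_density alpha y.
Proof.
rewrite mulr_ge0//; last by rewrite prodr_ge0// => i _; rewrite powR_ge0.
by rewrite divr_ge0 ?gamma_ge0// prodr_ge0// => k _; rewrite gamma_ge0.
Qed.

Section Exchange.
Variables (R : realType) (X : ptopologicalType).
Variables (nu : {measure set borel X -> \bar R}) (D : Prob R (Prob R X)).
Hypothesis nufin : (nu setT < +oo)%E.
Hypothesis nuD : dirichlet_ferguson nu D.

Lemma masses_measurable k (A : 'I_k -> set (borel X)) :
  (forall i, continuity_limit_set R (A i : set X)) ->
  measurable_fun setT (masses A : borel (Prob R X) -> k.-tuple R).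
Proof.
move=> cA; apply/measurable_fun_tnthP => i.
rewrite (_ : _ \o _ = fun eta : borel (Prob R X) => fine ((eta : Prob R X) (A i))).
  exact: mass_measurable.
by apply/funext => eta /=; rewrite tnth_mktuple.
Qed.

Lemma finite_mass (A : set (borel X)) : measurable A -> nu A \is a fin_num.
Proof.
move=> mA; rewrite ge0_fin_numE//; apply: le_lt_trans nufin.
by apply: le_measure; rewrite ?inE.
Qed.

(** The exchange relation of [dirichlet_exchange], carried over to the law of the
    masses. *)
Lemma partition_exchange n (A : 'I_n.+2 -> set (borel X)) (m : 'I_n.+2 -> nat)
    (i j : 'I_n.+2) : val i = n -> val j = n.+1 ->
  borel_partition A -> (forall k, 0 < nu (A k))%E ->
  (forall k, continuity_limit_set R (A k : set X)) ->
  let F (k l : 'I_n.+2) (eta : Prob R X) :=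
    (fine (nu (A k)) + (m k)%:R) *
    (fine (eta (A l)) * \prod_e fine (eta (A e)) ^+ m e) in
  \int[D]_eta F i j eta = \int[D]_eta F j i eta.
Proof.
move=> iE jE pA nuA cA F.
pose alpha k := fine (nu (A k)).
have alpha0 k : 0 < alpha k.
  by rewrite fine_gt0// nuA -ge0_fin_numE// finite_mass//; case: pA.
pose y (z : n.+1.-tuple R) : n.+2.-tuple R := [tuple of rcons z (1 - \sum_k tnth z k)].
pose w z := \1_(@simplex R n.+2) (y z) * dirichlet_density alpha (y z).
have my : measurable_fun setT y by exact: measurable_rcons_compl.
have mw : measurable_fun setT w.
  apply: measurable_funM.
    have mS : measurable_fun setT (\1_(@simplex R n.+2) : n.+2.-tuple R -> R).
      by apply: measurable_indic; exact: measurable_simplex.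
    exact: (measurableT_comp mS my).
  exact: (measurableT_comp (measurable_dirichlet_density alpha) my).
have w0 z : 0 <= w z by rewrite mulr_ge0// dirichlet_density_ge0.
have H := @integral_lebesgue_iter R _ _ _ (borel (Prob R X)) _ (D : Prob R (Prob R X))
  (masses A) y w (masses_measurable cA) my mw w0.
have DE B : measurable B -> D (masses A @^-1` B) =
    lebesgue_iter (fun z => (\1_B (y z) * w z)%:E).
  move=> mB; rewrite -[LHS]/(pushforward D (masses A) B) (nuD.1 _ _ pA nuA _ mB).
  by rewrite /dirichlet; apply: eq_lebesgue_iter => z; rewrite /w mulrA indicI.
pose G k l (t : n.+2.-tuple R) := (alpha k + (m k)%:R) * (tnth t l * \prod_e tnth t e ^+ m e).
have FG k l eta : F k l eta = G k l (masses A eta).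
  rewrite /F /G tnth_mktuple; congr (_ * (_ * _)).
  by apply: eq_bigr => e _; rewrite tnth_mktuple.
have G0 k l eta : 0 <= G k l (masses A eta).
  rewrite -FG /F; apply: mulr_ge0; first exact: addr_ge0 (ltW (alpha0 k)) _.
  rewrite mulr_ge0 ?fine_ge0// prodr_ge0// => e _.
  by rewrite exprn_ge0// fine_ge0.
have mG k l : measurable_fun setT (fun t => `|G k l t|).
  apply: measurableT_comp => //; apply: measurable_funM; first exact: measurable_cst.
  apply: measurable_funM; first exact: measurable_tnth.
  apply: measurable_prod => e _; apply: measurable_funX; exact: measurable_tnth.
(* the absolute value makes the integrand nonnegative also off the simplex,
   where [w] vanishes *)
have absG k l z : `|G k l (y z)| * w z = G k l (y z) * w z.
  have [[y0 _]|ny] := pselect (@simplex R n.+2 (y z)).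
    rewrite ger0_norm//; apply: mulr_ge0; first exact: addr_ge0 (ltW (alpha0 k)) _.
    by rewrite mulr_ge0// prodr_ge0// => e _; rewrite exprn_ge0.
  by rewrite /w indicE memNset// mul0r !mulr0.
have step k l : \int[D]_eta F k l eta =
    fine (lebesgue_iter (fun z => (G k l (y z) * w z)%:E)).
  rewrite /Rintegral; congr fine.
  transitivity (\int[D]_eta (`|G k l (masses A eta)|)%:E)%E.
    by apply: eq_integral => eta _; rewrite FG ger0_norm.
  rewrite (H DE _ (mG k l) (fun t => normr_ge0 _)).
  by apply: eq_lebesgue_iter => z; rewrite absG.
rewrite !step; congr fine; exact: (dirichlet_exchange m iE jE alpha0).
Qed.

End Exchange.

(** * Moments of finitely valued functions *)

(** The blocks are the fibres of a finitely valued [q]; by [q_nonnull] a block is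
    either empty or of positive mass, so that the nonempty ones form a partition
    whose masses have a Dirichlet law. *)
Section Urn.
Variables (R : realType) (X : ptopologicalType).
Variables (nu : {measure set borel X -> \bar R}) (D : Prob R (Prob R X)).
Hypothesis nufin : (nu setT < +oo)%E.
Hypothesis nuD : dirichlet_ferguson nu D.
Variables (K : finType) (q : X -> K).
Local Notation A c := (q @^-1` [set c] : set (borel X)).
Hypothesis cq : forall c, continuity_limit_set R (A c : set X).
Hypothesis q_nonnull : forall c, nu (A c) = 0%E -> A c = set0.

Let alpha c := fine (nu (A c)).
Let y c (eta : borel (Prob R X)) := fine ((eta : Prob R X) (A c)).
Local Notation E f := (\int[D]_eta f eta).

Let mA c : measurable (A c).
Proof. exact: continuity_limit_set_measurable (cq c). Qed.

Let y_ge0 c eta : 0 <= y c eta. Proof. by rewrite fine_ge0. Qed.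

Let Dfin : ((D : {measure set borel (Prob R X) -> \bar R}) setT < +oo)%E.
Proof. by rewrite [X in (X < _)%E]probability_setT ltry. Qed.

Lemma sum_fine_fibres (m : {measure set borel X -> \bar R}) : (m setT < +oo)%E ->
  \sum_c fine (m (A c)) = fine (m setT).
Proof.
move=> mfin.
have fA c : m (A c) \is a fin_num.
  rewrite ge0_fin_numE//; apply: le_lt_trans mfin.
  by apply: le_measure; rewrite ?inE.
apply: EFin_inj; rewrite fineK; last by rewrite ge0_fin_numE.
rewrite -sumEFin (eq_bigr (fun c => m (A c))); last by move=> c _; rewrite fineK.
have -> : setT = \bigcup_(c in [set: K]) A c.
  by apply/seteqP; split => // x _; exists (q x).
rewrite measure_fin_bigcup//.
- rewrite (fsbigE (index_enum K)) ?index_enum_uniq//; last first.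
    by move=> c _; rewrite mem_index_enum.
  by apply: eq_bigl => c; rewrite in_setT.
- exact: finite_finset.
- by move=> c d _ _ [x [/= <- <-]].
Qed.

Let sum_y eta : \sum_c y c eta = 1.
Proof.
rewrite /y sum_fine_fibres; first by rewrite [X in fine X]probability_setT.
by rewrite [X in (X < _)%E]probability_setT ltry.
Qed.

Let sum_alpha : \sum_c alpha c = fine (nu setT).
Proof. exact: sum_fine_fibres. Qed.

Let y_le1 c eta : y c eta <= 1.
Proof.
rewrite -(sum_y eta) (bigD1 c)//= lerDl sumr_ge0// => *; exact: y_ge0.
Qed.

Let by_ c : bounded_measurable (y c).
Proof.
split; first exact: mass_measurable.
by exists 1 => eta; rewrite ger0_norm.
Qed.

Let bym (m : K -> nat) : bounded_measurable (fun eta => \prod_e y e eta ^+ m e).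
Proof. by apply: bounded_measurable_prod => e; apply: bounded_measurableX. Qed.

Let null_y c : alpha c = 0 -> forall eta, y c eta = 0.
Proof.
move=> ac eta; rewrite /y q_nonnull ?measure0//.
by rewrite -(fineK (finite_mass nufin (mA c))) -/(alpha c) ac.
Qed.

(** The blocks of positive mass are listed with [c] and [d] in the last two
    places.  If an empty block is involved, through [c], [d] or an exponent, then
    both sides vanish. *)
Lemma fibre_exchange c d (m : K -> nat) :
  (alpha c + (m c)%:R) * E (fun eta => y d eta * \prod_e y e eta ^+ m e) =
  (alpha d + (m d)%:R) * E (fun eta => y c eta * \prod_e y e eta ^+ m e).
Proof.
have [->//|cd] := eqVneq c d.
have alpha_ge0 e : 0 <= alpha e by exact: fine_ge0.
have [/existsP[e /andP[/eqP ae me]]|] := boolP [exists e, (alpha e == 0) && (m e != 0)%N].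
  have p0 eta : \prod_e y e eta ^+ m e = 0.
    by rewrite (bigD1 e)//= null_y// expr0n (negbTE me) mul0r.
  by under eq_Rintegral do rewrite p0 mulr0;
    under [in RHS]eq_Rintegral do rewrite p0 mulr0; rewrite Rintegral_cst// mul0r !mulr0.
rewrite negb_exists => /forallP m0.
have {}m0 e : alpha e = 0 -> m e = 0%N.
  by move=> ae; have := m0 e; rewrite ae eqxx /= negbK => /eqP.
have E0 e : alpha e = 0 -> E (fun eta => y e eta * \prod_e y e eta ^+ m e) = 0.
  move=> ae; under eq_Rintegral do rewrite null_y// mul0r.
  by rewrite Rintegral_cst// mul0r.
have [ac|ac] := eqVneq (alpha c) 0; first by rewrite (E0 c ac) ac (m0 c ac) addr0 !mul0r mulr0.
have [ad|ad] := eqVneq (alpha d) 0; first by rewrite (E0 d ad) ad (m0 d ad) addr0 !mul0r mulr0.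
pose r := [seq e <- enum K | [&& alpha e != 0, e != c & e != d]].
pose n := size r.
pose s := r ++ [:: c; d].
have us : uniq s.
  rewrite cat_uniq filter_uniq ?enum_uniq//= inE cd !andbT/= !mem_filter.
  by rewrite !eqxx !andbF.
have sn : size s = n.+2 by rewrite size_cat addn2.
have ms e : (e \in s) = (alpha e != 0).
  rewrite mem_cat mem_filter mem_enum !inE andbT.
  case: (eqVneq e c) => [->|_]; first by rewrite orbT ac.
  case: (eqVneq e d) => [->|_]; first by rewrite orbT ad.
  by case: (alpha e == 0).
pose B (i : 'I_n.+2) := A (nth c s i).
pose i : 'I_n.+2 := inord n.
have iE : val i = n by rewrite /= inordK.
have si : nth c s i = c.
  by rewrite [X in nth _ _ X]iE nth_cat ltnn subnn.
have sj : nth c s (@ord_max n.+1) = d.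
  by rewrite nth_cat/= ltnNge leqnSn/= subSnn.
have pB : borel_partition B.
  split; first by move=> k; exact: mA.
    move=> k l _ _ [x [/= e1 e2]]; apply: val_inj => /=; apply/eqP.
    by rewrite -(nth_uniq c _ _ us) ?sn// -e1 -e2.
  apply/seteqP; split => // x _.
  have : q x \in s.
    rewrite ms; apply/eqP => aq; have : A (q x) = set0.
      apply: q_nonnull; rewrite -(fineK (finite_mass nufin (mA (q x)))).
      by rewrite -/(alpha (q x)) aq.
    by move/seteqP => [/(_ x erefl)].
  move=> /[dup] qs; rewrite -index_mem sn => ql.
  by exists (Ordinal ql) => //; exact/esym/nth_index.
have nuB k : (0 < nu (B k))%E.
  have : nth c s k \in s by rewrite mem_nth// sn.
  rewrite ms lt_neqAle measure_ge0 andbT => h; apply: contra h => /eqP h.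
  by rewrite /alpha -h.
have prodE eta : \prod_(k < n.+2) fine ((eta : Prob R X) (B k)) ^+ m (nth c s k) =
    \prod_e y e eta ^+ m e.
  rewrite [RHS](bigID [in s])/= [X in _ = _ * X]big1 ?mulr1; last first.
    by move=> e; rewrite ms negbK => /eqP /m0 ->; rewrite expr0.
  by rewrite -big_uniq// (big_nth c) sn big_mkord.
have := partition_exchange nufin nuD (fun k => m (nth c s k)) iE (erefl : val ord_max = n.+1)
  pB nuB (fun k => cq _).
rewrite /= si sj => H.
rewrite -!bounded_RintegralZl//; try by apply: bounded_measurableM.
transitivity (\int[D]_eta ((fine (nu (B i)) + (m (nth c s i))%:R) *
  (fine ((eta : Prob R X) (B ord_max)) * \prod_(k < n.+2) fine (eta (B k)) ^+ m (nth c s k)))).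
  by apply: eq_Rintegral => eta _; rewrite prodE /B si sj.
rewrite si H; apply: eq_Rintegral => eta _; by rewrite prodE /B si sj.
Qed.

(** The sum of [fibre_exchange] over [c]: the masses of the blocks add up to 1. *)
Lemma fibre_step d (m : K -> nat) :
  (fine (nu setT) + (\sum_c m c)%:R) *
    E (fun eta => y d eta * \prod_e y e eta ^+ m e) =
  (alpha d + (m d)%:R) * E (fun eta => \prod_e y e eta ^+ m e).
Proof.
rewrite -sum_alpha natr_sum -big_split mulr_suml/=.
rewrite (eq_bigr _ (fun c _ => fibre_exchange c d m)) -mulr_sumr; congr (_ * _).
rewrite -bounded_Rintegral_sum//; last by move=> c; exact: bounded_measurableM.
by apply: eq_Rintegral => eta _; rewrite -mulr_suml sum_y mul1r.
Qed.

Let Y (a : K -> R) (eta : borel (Prob R X)) := \sum_c a c * y c eta.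
Let nu_of (a : K -> R) := \sum_c a c * alpha c.

Let bY a : bounded_measurable (Y a).
Proof.
apply: bounded_measurable_sum => c; apply: bounded_measurableM => //.
exact: bounded_measurable_cst.
Qed.

Let prod_fibre n (h : 'I_n -> K) eta :
  \prod_i y (h i) eta = \prod_e y e eta ^+ #|[pred i | h i == e]|.
Proof.
rewrite (partition_big h xpredT)//=; apply: eq_bigr => e _.
by rewrite -prodr_const; apply: eq_big => // i /eqP ->.
Qed.

Let sum_fibre n (h : 'I_n -> K) : (\sum_e #|[pred i | h i == e]|)%N = n.
Proof.
rewrite -[RHS](card_ord n) -sum1_card (partition_big h xpredT)//=.
by apply: eq_bigr => e _; rewrite -sum1_card; apply: eq_bigl.
Qed.

Let expand n (a : 'I_n -> K -> R) eta :
  \prod_i Y (a i) eta =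
  \sum_(h : {ffun 'I_n -> K}) (\prod_i a i (h i)) * \prod_i y (h i) eta.
Proof.
rewrite bigA_distr_bigA/=; apply: eq_bigr => h _.
by rewrite big_split.
Qed.

Let by_prod n (h : 'I_n -> K) : bounded_measurable (fun eta => \prod_i y (h i) eta).
Proof. exact: bounded_measurable_prod. Qed.

Let E_expand n (a : 'I_n -> K -> R) :
  E (fun eta => \prod_i Y (a i) eta) = \sum_(h : {ffun 'I_n -> K})
    (\prod_i a i (h i)) * E (fun eta => \prod_i y (h i) eta).
Proof.
under eq_Rintegral do rewrite expand.
rewrite bounded_Rintegral_sum//; last first.
  by move=> h; apply: bounded_measurableM => //; exact: bounded_measurable_cst.
by apply: eq_bigr => h _; rewrite bounded_RintegralZl.
Qed.

(** One draw from the urn: expand into monomials in the masses and apply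
    [fibre_step].  The term [alpha d] gives the new factor on its own, and each
    of the [n] draws counted by [m d] gives the new factor multiplied into that
    draw. *)
Lemma urn_recursion n (a : 'I_n.+1 -> K -> R) :
  (fine (nu setT) + n%:R) * E (fun eta => \prod_i Y (a i) eta) =
  nu_of (a ord0) * E (fun eta => \prod_i Y (a (lift ord0 i)) eta) +
  \sum_(i < n) E (fun eta => \prod_j Y (fun c =>
     if j == i then a (lift ord0 j) c * a ord0 c else a (lift ord0 j) c) eta).
Proof.
pose w (h : {ffun 'I_n -> K}) := \prod_i a (lift ord0 i) (h i).
pose e (h : {ffun 'I_n -> K}) := E (fun eta => \prod_i y (h i) eta).
have e_step (h : {ffun 'I_n -> K}) d :
    (fine (nu setT) + n%:R) * E (fun eta => y d eta * \prod_i y (h i) eta) =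
    (alpha d + (\sum_(i < n) (h i == d))%:R) * e h.
  have := fibre_step d (fun e => #|[pred i | h i == e]|).
  rewrite sum_fibre; under eq_Rintegral do rewrite -prod_fibre.
  under [in RHS]eq_Rintegral do rewrite -prod_fibre.
  by move=> ->; rewrite -sum1_card big_mkcond.
have -> : E (fun eta => \prod_i Y (a i) eta) = \sum_d \sum_(h : {ffun 'I_n -> K})
    (a ord0 d * w h) * E (fun eta => y d eta * \prod_i y (h i) eta).
  transitivity (E (fun eta => \sum_d \sum_(h : {ffun 'I_n -> K})
      (a ord0 d * w h) * (y d eta * \prod_i y (h i) eta))).
    apply: eq_Rintegral => eta _; rewrite big_ord_recl expand mulr_suml.
    apply: eq_bigr => d _; rewrite mulr_sumr; apply: eq_bigr => h _.
    by rewrite /w; ring.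
  have bM d (h : {ffun 'I_n -> K}) :
      bounded_measurable (fun eta => y d eta * \prod_i y (h i) eta).
    exact: bounded_measurableM.
  rewrite bounded_Rintegral_sum//; last first.
    move=> d; apply: bounded_measurable_sum => h.
    by apply: bounded_measurableM => //; exact: bounded_measurable_cst.
  apply: eq_bigr => d _; rewrite bounded_Rintegral_sum//; last first.
    by move=> h; apply: bounded_measurableM => //; exact: bounded_measurable_cst.
  by apply: eq_bigr => h _; rewrite bounded_RintegralZl.
rewrite mulr_sumr.
transitivity (\sum_d \sum_(h : {ffun 'I_n -> K})
    a ord0 d * w h * ((alpha d + (\sum_(i < n) (h i == d))%:R) * e h)).
  apply: eq_bigr => d _; rewrite mulr_sumr; apply: eq_bigr => h _.
  by rewrite mulrCA e_step.
rewrite exchange_big/= E_expand mulr_sumr.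
under [X in _ = _ + X]eq_bigr do rewrite E_expand.
rewrite [X in _ = _ + X]exchange_big/= -big_split/=; apply: eq_bigr => h _.
rewrite -/(w h) -/(e h) /nu_of mulr_suml.
transitivity (\sum_d (a ord0 d * alpha d * (w h * e h)) +
    \sum_(i < n) \sum_d (a ord0 d * (h i == d)%:R) * (w h * e h)).
  rewrite [X in _ = _ + X]exchange_big -big_split/=; apply: eq_bigr => d _.
  by rewrite -mulr_suml -mulr_sumr natr_sum; ring.
congr (_ + _); apply: eq_bigr => i _.
rewrite -mulr_suml (bigD1 (h i))//= eqxx mulr1 big1 ?addr0; last first.
  by move=> d; rewrite eq_sym => /negbTE ->; rewrite mulr0.
rewrite mulrA; congr (_ * _); rewrite /w (bigD1 i)//= [RHS](bigD1 i)//= eqxx.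
rewrite mulrA [a ord0 _ * _]mulrC; congr (_ * _).
by apply: eq_bigr => j /negbTE ->.
Qed.

(** Both sides obey the same recursion, [urn_recursion] on the left and
    [sum_cycles_recl] on the right: a factor on its own is a fixed point. *)
Lemma urn_moment n (a : 'I_n -> K -> R) :
  \prod_(k < n) (fine (nu setT) + k%:R) * E (fun eta => \prod_i Y (a i) eta) =
  \sum_(s : 'S_n) \prod_(c in porbits s) nu_of (fun k => \prod_(j in c) a j k).
Proof.
elim: n a => [|n IH] a.
  rewrite big_ord0 mul1r; under eq_Rintegral do rewrite big_ord0.
  rewrite Rintegral_cst// [X in fine X]probability_setT mulr1.
  have porb0 (s : 'S_0) : porbits s = finset.set0.
    by apply/setP => c; rewrite inE; apply/imsetP => -[[]].
  rewrite (eq_bigr (fun=> 1)); last by move=> s _; rewrite porb0 big_set0.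
  by rewrite sumr_const card_Sn.
rewrite big_ord_recr/= -mulrA urn_recursion mulrDr mulrCA IH [X in _ + X = _]mulr_sumr.
have lift_prod (c : {set 'I_n}) k : \prod_(j in lift_set c) a j k =
    \prod_(j in c) a (lift ord0 j) k.
  by rewrite big_imset//= => i j _ _; exact: lift_inj.
rewrite (sum_cycles_recl (fun c => nu_of (fun k => \prod_(j in c) a j k))).
congr (_ + _).
  congr (_ * _); first by congr nu_of; apply/funext => k; rewrite big_set1.
  apply: eq_bigr => s _; apply: eq_bigr => c _; congr nu_of; apply/funext => k.
  by rewrite lift_prod.
apply: eq_bigr => i _.
rewrite (IH (fun j c => if j == i then a (lift ord0 j) c * a ord0 c
                        else a (lift ord0 j) c)).
apply: eq_bigr => s _; apply: eq_bigr => c _.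
congr nu_of; apply/funext => k; rewrite /insert_set; case: ifPn => ic.
  rewrite big_setU1 ?mem0_lift_set//= lift_prod (bigD1 i)//= eqxx.
  rewrite [in RHS](bigD1 i)//= -mulrA mulrCA.
  by congr (_ * (_ * _)); apply: eq_bigr => j /andP[_ /negbTE ->].
rewrite lift_prod; apply: eq_bigr => j jc; case: eqP => // ji.
by rewrite -ji jc in ic.
Qed.

End Urn.

(** * Null blocks *)

Section CvgBig.
Variables (R : realType) (T : Type) (F : set_system T) (FF : Filter F).

Lemma cvg_sum_fun I (s : seq I) (P : pred I) (h : I -> T -> R) (l : I -> R) :
  (forall i, h i x @[x --> F] --> l i) ->
  \sum_(i <- s | P i) h i x @[x --> F] --> \sum_(i <- s | P i) l i.
Proof.
by move=> hl; apply: cvg_big => //; exact: add_continuous.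
Qed.

Lemma cvg_prod_fun I (s : seq I) (P : pred I) (h : I -> T -> R) (l : I -> R) :
  (forall i, h i x @[x --> F] --> l i) ->
  \prod_(i <- s | P i) h i x @[x --> F] --> \prod_(i <- s | P i) l i.
Proof.
by move=> hl; apply: cvg_big => //; exact: mul_continuous.
Qed.

End CvgBig.

Section Quantize.
Variables (R : realType) (X : ptopologicalType).

Lemma Rintegral_fibre (m : {measure set borel X -> \bar R}) (K : finType)
    (q : X -> K) (a : K -> R) : (m setT < +oo)%E ->
  (forall c, measurable (q @^-1` [set c] : set (borel X))) ->
  \int[m]_x a (q x) = \sum_c a c * fine (m (q @^-1` [set c])).
Proof.
move=> mfin mq.
transitivity (\int[m]_x \sum_c a c * \1_(q @^-1` [set c]) x).
  apply: eq_Rintegral => x _; rewrite (bigD1 (q x))//= indicE mem_set//= mulr1.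
  rewrite big1 ?addr0// => c cq; rewrite indicE memNset ?mulr0//= => qc.
  by rewrite qc eqxx in cq.
rewrite bounded_Rintegral_sum//; last first.
  move=> c; apply: bounded_measurableM; first exact: bounded_measurable_cst.
  exact: bounded_measurable_indic.
apply: eq_bigr => c _; rewrite bounded_RintegralZl ?Rintegral_indicT//.
exact: bounded_measurable_indic.
Qed.

Lemma bounded_measurable_fibre (K : finType) (q : X -> K) (a : K -> R) :
  (forall c, measurable (q @^-1` [set c] : set (borel X))) ->
  bounded_measurable (fun x : borel X => a (q x)).
Proof.
move=> mq; rewrite (_ : (fun x => _) = fun x : borel X => \sum_c a c * \1_(q @^-1` [set c]) x).
  apply: bounded_measurable_sum => c; apply: bounded_measurableM.
    exact: bounded_measurable_cst.
  exact: bounded_measurable_indic.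
apply/funext => x; rewrite (bigD1 (q x))//= indicE mem_set//= mulr1.
rewrite big1 ?addr0// => c cq; rewrite indicE memNset ?mulr0//= => qc.
by rewrite qc eqxx in cq.
Qed.

Lemma prob_fin (eta : Prob R X) :
  ((eta : {measure set borel X -> \bar R}) setT < +oo)%E.
Proof. by rewrite [X in (X < _)%E]probability_setT ltry. Qed.

Variables (nu : {measure set borel X -> \bar R}) (D : Prob R (Prob R X)).
Hypothesis nufin : (nu setT < +oo)%E.
Hypothesis nu0 : nu setT <> 0%E.
Hypothesis nuD : dirichlet_ferguson nu D.

(** The union [N] of the null blocks is moved into a block [A d] of positive
    mass.  This changes integrals neither against [nu] nor against [D]-almost
    every [eta], because [eta N = 0] almost surely. *)
Lemma quantized_moment (K : finType) (q : X -> K) n (a : 'I_n -> K -> R) :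
  (forall c, continuity_limit_set R (q @^-1` [set c])) ->
  \prod_(k < n) (fine (nu setT) + k%:R) *
    \int[D]_eta \prod_i \int[(eta : Prob R X)]_x a i (q x) =
  \sum_(s : 'S_n) \prod_(c in porbits s) \int[nu]_x \prod_(j in c) a j (q x).
Proof.
move=> cq; pose A c : set (borel X) := q @^-1` [set c].
have mA c : measurable (A c) by exact: continuity_limit_set_measurable (cq c).
have [d nud] : exists d, nu (A d) != 0%E.
  apply: contrapT => /forallNP nuA.
  have nuA0 c : nu (A c) = 0%E by apply/eqP/negP => /negP; exact: nuA.
  have := sum_fine_fibres cq nufin; rewrite big1; last first.
    by move=> c _; rewrite -/(A c) nuA0.
  by move=> e; apply: nu0; rewrite -[LHS]fineK ?ge0_fin_numE// -e.
pose q' x := if nu (A (q x)) == 0%E then d else q x.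
pose N : set (borel X) := \bigcup_(c in [set` [seq c <- enum K | nu (A c) == 0%E]]) A c.
have cN : continuity_limit_set R (N : set X).
  by apply: continuity_limit_set_bigcup => c _; exact: cq.
have NE x : N x <-> nu (A (q x)) = 0%E.
  split => [[c /=]|h]; first by rewrite mem_filter => /andP[/eqP + _] ->.
  by exists (q x) => //=; rewrite mem_filter mem_enum h eqxx.
have qN x : ~ N x -> q' x = q x.
  by move=> /NE h; rewrite /q'; case: eqP.
have nuN : nu N = 0%E.
  have mN : measurable N by exact: continuity_limit_set_measurable cN.
  rewrite -(fineK (finite_mass nufin mN)) -Rintegral_indicT//.
  transitivity ((\int[nu]_x (nu (A (q x)) == 0%E)%:R)%:E : \bar R).
    congr EFin; apply: eq_Rintegral => x _; rewrite indicE.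
    suff -> : (x \in N) = (nu (A (q x)) == 0%E) by [].
    by apply/idP/eqP; rewrite inE => /NE.
  rewrite (Rintegral_fibre (fun c => (nu (A c) == 0%E)%:R))// big1// => c _.
  by case: eqP => [->|]; rewrite ?mulr0 ?mul0r.
have cq' c : continuity_limit_set R (q' @^-1` [set c]).
  rewrite (_ : _ @^-1` _ = (if c == d then N else set0) `|` (A c `&` ~` N)).
    apply: continuity_limit_setU.
      by case: ifP => // _; exact: continuity_limit_set0.
    by apply: continuity_limit_setI; [exact: cq|exact: continuity_limit_setC].
  apply/seteqP; split => x /=; rewrite /q'.
    case: eqP => [/NE Nx <-|nx <-]; first by left; rewrite eqxx.
    by right; split => // /NE.
  move=> [|[qx Nx]]; last by case: eqP => // /NE.
  by case: (c =P d) => // -> /NE ->; rewrite eqxx.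
have q'0 c : nu (q' @^-1` [set c] : set (borel X)) = 0%E ->
    q' @^-1` [set c] = set0 :> set (borel X).
  move=> q'c; apply/seteqP; split => // x /= xc.
  have nuc : nu (A c) != 0%E by rewrite -xc /q'; case: ifPn.
  have : (nu (A c) <= nu (q' @^-1` [set c] : set (borel X)))%E.
    apply: le_measure; rewrite ?inE//.
      exact: continuity_limit_set_measurable (cq' c).
    by move=> z /= zc; rewrite /q' zc (negbTE nuc).
  by rewrite q'c measure_le0 (negbTE nuc).
have mA' c : measurable (q' @^-1` [set c] : set (borel X)).
  exact: continuity_limit_set_measurable (cq' c).
have transfer (m : {measure set borel X -> \bar R}) (b : K -> R) : m N = 0%E ->
    \int[m]_x b (q x) = \int[m]_x b (q' x).
  move=> mN; rewrite /Rintegral; congr fine; apply: ae_eq_integral => //.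
  - by apply/measurable_EFinP; case: (bounded_measurable_fibre b mA).
  - by apply/measurable_EFinP; case: (bounded_measurable_fibre b mA').
  - exists N; split => //; first exact: continuity_limit_set_measurable cN.
    by move=> x /= h; apply: contrapT => /qN e; apply: h; rewrite e.
have Y_measurable (b : K -> R) (r : X -> K) :
    (forall c, continuity_limit_set R (r @^-1` [set c])) ->
    measurable_fun setT (fun eta : borel (Prob R X) => \int[(eta : Prob R X)]_x b (r x)).
  move=> cr; rewrite (_ : (fun eta => _) = fun eta : borel (Prob R X) =>
    \sum_c b c * fine ((eta : Prob R X) (r @^-1` [set c]))).
    apply: measurable_sum => c; apply: measurable_funM; first exact: measurable_cst.
    exact: mass_measurable.
  apply/funext => eta; rewrite Rintegral_fibre//; first exact: prob_fin.
  by move=> c; exact: continuity_limit_set_measurable.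
transitivity (\prod_(k < n) (fine (nu setT) + k%:R) *
    \int[D]_eta \prod_i \sum_c a i c * fine ((eta : Prob R X) (q' @^-1` [set c]))).
  congr (_ * _); rewrite /Rintegral; congr fine; apply: ae_eq_integral => //.
  - apply/measurable_EFinP; apply: measurable_prod => i _; exact: Y_measurable.
  - apply/measurable_EFinP; apply: measurable_prod => i _.
    apply: measurable_sum => c; apply: measurable_funM; first exact: measurable_cst.
    exact: mass_measurable.
  - have [M [mM DM subM]] := nuD.2 N (continuity_limit_set_measurable cN) nuN.
    exists M; split => // eta /= h; apply: subM => etaN; apply: h => _.
    congr EFin; apply: eq_bigr => i _; apply: etrans (transfer _ (a i) etaN) _.
    by rewrite Rintegral_fibre//; exact: prob_fin.
rewrite (urn_moment nufin nuD cq' q'0); apply: eq_bigr => s _; apply: eq_bigr => c _.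
rewrite [RHS](transfer nu (fun k => \prod_(j in c) a j k) nuN).
by rewrite (Rintegral_fibre (fun k => \prod_(j in c) a j k)).
Qed.

End Quantize.

(** * Moments of continuous functions *)

Section Moments.
Variables (R : realType) (X : ptopologicalType).

(** The [f i] are rounded down to multiples of [e].  A block is cut out by strict
    inequalities between continuous functions and by their negations. *)
Lemma quantization n (f : 'I_n -> X -> R) (M e : R) :
  (forall i, continuous (f i)) -> (forall i x, `|f i x| <= M) -> 0 < e ->
  exists (K : finType) (q : X -> K) (a : 'I_n -> K -> R),
    (forall c, continuity_limit_set R (q @^-1` [set c])) /\
    (forall i x, `|a i (q x) - f i x| <= e).
Proof.
move=> cf fM e0.
pose g i x := (f i x + M) / e.
have fM' i x : - M <= f i x <= M by rewrite -ler_norml.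
have g0 i x : 0 <= g i x.
  by rewrite divr_ge0 ?(ltW e0)// -lerBlDr sub0r; case/andP: (fM' i x).
pose L := Num.truncn ((M + M) / e).
have gL i x : (Num.truncn (g i x) < L.+1)%N.
  rewrite ltnS; apply: le_truncn; rewrite ler_pM2r ?invr_gt0//.
  by rewrite lerD2r; case/andP: (fM' i x).
pose q x : {ffun 'I_n -> 'I_L.+1} := [ffun i => inord (Num.truncn (g i x))].
have qE x i : (q x i : nat) = Num.truncn (g i x) by rewrite ffunE inordK.
exists {ffun 'I_n -> 'I_L.+1}, q, (fun i (c : {ffun 'I_n -> 'I_L.+1}) => (c i)%:R * e - M); split=> [c|i x].
  have -> : q @^-1` [set c] = \bigcap_(i in [set` enum 'I_n])
      (~` [set x | - (c i)%:R < - g i x] `&` [set x | - (c i).+1%:R < - g i x]).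
    apply/seteqP; split => [x /= <- i _|x /= h].
      have /andP[t1 t2] := truncn_itv (g0 i x).
      by rewrite /= !ltrN2 qE; split => //; apply/negP; rewrite -leNgt.
    apply/ffunP => i; apply/val_inj => /=; rewrite qE.
    have [/= ] := h i (mem_enum _ _); rewrite !ltrN2 => /negP; rewrite -leNgt => h1 h2.
    by apply: truncn_def; rewrite h1.
  have cg i : continuous (fun x => - g i x).
    move=> x; apply: cvgN; apply: cvgM; last exact: cvg_cst.
    by apply: cvgD; [exact: cf|exact: cvg_cst].
  apply: continuity_limit_set_bigcap => i _; apply: continuity_limit_setI.
    by apply: continuity_limit_setC; exact: continuity_limit_set_gt.
  exact: continuity_limit_set_gt.
rewrite qE.
have /andP[t1 t2] := truncn_itv (g0 i x).
have ge : g i x * e = f i x + M by rewrite mulfVK// gt_eqF.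
move: t1 t2; rewrite -(ler_pM2r e0) -(ltr_pM2r e0) ge -natr1 mulrDl mul1r => t1 t2.
rewrite ler_norml; lra.
Qed.

Variables (nu : {measure set borel X -> \bar R}) (D : Prob R (Prob R X)).
Hypothesis nufin : (nu setT < +oo)%E.
Hypothesis nu0 : nu setT <> 0%E.
Hypothesis nuD : dirichlet_ferguson nu D.

Lemma integral_eval_measurable (f : X -> R) : continuous f ->
  (exists M : R, forall x, `|f x| <= M) ->
  measurable_fun setT (fun eta : borel (Prob R X) => \int[(eta : Prob R X)]_x f x).
Proof.
move=> cf bf; apply: (@continuous_borel_measurable R (Prob R X)
  (fun eta => \int[eta]_x f x)).
exact: integral_eval_continuous.
Qed.

Lemma le_norm_Rintegral_prob (eta : Prob R X) (f : X -> R) (M : R) :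
  bounded_measurable (f : borel X -> R) -> (forall x, `|f x| <= M) ->
  `|\int[eta]_x f x| <= M.
Proof.
move=> bf fM.
have cM (c : R) : \int[eta]_x (cst c x) = c.
  by rewrite Rintegral_cst// [X in _ * fine X]probability_setT mulr1.
have bc (c : R) := @bounded_measurable_cst _ (borel X) R c.
have efin := prob_fin eta.
have fM' x : - M <= f x <= M by rewrite -ler_norml.
rewrite ler_norml -{1}(cM (- M)) -{2}(cM M); apply/andP; split.
  apply: le_bounded_Rintegral; [exact: efin|exact: bc|exact: bf|].
  by move=> x; case/andP: (fM' x).
apply: le_bounded_Rintegral; [exact: efin|exact: bf|exact: bc|].
by move=> x; case/andP: (fM' x).
Qed.

Lemma quantized_moment_approx n (f : 'I_n -> X -> R) (e : R) :
  (forall i, continuous (f i)) -> (exists M : R, forall i x, `|f i x| <= M) -> 0 < e ->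
  exists g : 'I_n -> X -> R,
    [/\ forall i x, `|g i x - f i x| <= e,
        forall i, measurable_fun setT (g i : borel X -> R),
        forall i, measurable_fun setT
          (fun eta : borel (Prob R X) => \int[(eta : Prob R X)]_x g i x) &
        \prod_(k < n) (fine (nu setT) + k%:R) *
          \int[D]_eta \prod_i \int[(eta : Prob R X)]_x g i x =
        \sum_(s : 'S_n) \prod_(c in porbits s) \int[nu]_x \prod_(j in c) g j x].
Proof.
move=> cf [M fM] e0; have [K [q [a [cq ae]]]] := quantization cf fM e0.
have mq c : measurable (q @^-1` [set c] : set (borel X)).
  exact: continuity_limit_set_measurable (cq c).
exists (fun i x => a i (q x)); split => //.
- by move=> i; case: (bounded_measurable_fibre (a i) mq).
- move=> i; rewrite (_ : (fun eta => _) = fun eta : borel (Prob R X) =>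
    \sum_c a i c * fine ((eta : Prob R X) (q @^-1` [set c]))).
    apply: measurable_sum => c; apply: measurable_funM; first exact: measurable_cst.
    exact: mass_measurable.
  by apply/funext => eta; rewrite (Rintegral_fibre (a i))//; exact: prob_fin.
- exact: quantized_moment.
Qed.

(** Both sides are continuous for bounded pointwise limits of the [f i], so
    finitely valued approximations suffice. *)
Theorem mixed_moment n (f : 'I_n -> X -> R) :
  (forall i, continuous (f i)) -> (exists M : R, forall i x, `|f i x| <= M) ->
  \prod_(k < n) (fine (nu setT) + k%:R) *
    \int[D]_eta \prod_i \int[(eta : Prob R X)]_x f i x =
  \sum_(s : 'S_n) \prod_(c in porbits s) \int[nu]_x \prod_(j in c) f j x.
Proof.
move=> cf bf.
have /choice[g gP] (k : nat) := quantized_moment_approx cf bf (harmonic_gt0 k).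
have [M fM] := bf.
have gM k i x : `|g k i x| <= M + 1.
  have [h _ _ _] := gP k.
  rewrite -(subrK (f i x) (g k i x)) addrC (le_trans (ler_normD _ _))// lerD//.
  by rewrite (le_trans (h i x))// invf_le1// ler1n.
have bg k i : bounded_measurable (g k i : borel X -> R).
  by split; [have [_ + _ _] := gP k|exists (M + 1)].
have gf i x : g k i x @[k --> \oo] --> f i x.
  apply/cvgrPdist_le => e e0; near=> k.
  rewrite distrC; have [h _ _ _] := gP k; apply: le_trans (h i x) _.
  near: k; apply: (cvgr_le 0) => //; exact: cvg_harmonic.
have gI i (eta : Prob R X) : \int[eta]_x g k i x @[k --> \oo] --> \int[eta]_x f i x.
  apply: (@bounded_cvg_Rintegral _ (borel X) R eta (prob_fin eta) _ _ (M + 1)) => // k.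
  by have [_ + _ _] := gP k.
have L : \prod_(k < n) (fine (nu setT) + k%:R) *
      \int[D]_eta \prod_i \int[(eta : Prob R X)]_x g k i x @[k --> \oo] -->
    \prod_(k < n) (fine (nu setT) + k%:R) *
      \int[D]_eta \prod_i \int[(eta : Prob R X)]_x f i x.
  apply: cvgM; first exact: cvg_cst.
  apply: (@bounded_cvg_Rintegral _ (borel (Prob R X)) R D (prob_fin D) _ _ ((M + 1) ^+ n)).
  - move=> k; apply: measurable_prod => i _; by have [_ _ + _] := gP k.
  - move=> k eta; rewrite normr_prod -[X in _ <= _ ^+ X]card_ord -prodr_const.
    apply: ler_prod => i _; rewrite normr_ge0/=.
    by apply: le_norm_Rintegral_prob => //; exact: bg.
  - by move=> eta; apply: cvg_prod_fun => i; exact: gI.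
have Rt : \sum_(s : 'S_n) \prod_(c in porbits s) \int[nu]_x \prod_(j in c) g k j x
      @[k --> \oo] -->
    \sum_(s : 'S_n) \prod_(c in porbits s) \int[nu]_x \prod_(j in c) f j x.
  apply: cvg_sum_fun => s; apply: cvg_prod_fun => c.
  apply: (@bounded_cvg_Rintegral _ (borel X) R nu nufin _ _ ((M + 1) ^+ #|c|)).
  - move=> k.
    by case: (bounded_measurable_prod (index_enum 'I_n) (fun j => j \in c) (bg k)).
  - move=> k x; rewrite normr_prod -prodr_const.
    by apply: ler_prod => i _; rewrite normr_ge0 gM.
  - by move=> x; apply: cvg_prod_fun => i; exact: gf.
rewrite -(cvg_lim _ L)// -(cvg_lim _ Rt)//; congr (limn _).
by apply/funext => k; have [_ _ _ ->] := gP k.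
Unshelve. all: by end_near. Qed.

End Moments.

(** * Series of moments and complex series *)

Section MomentSeries.
Variable R : realType.

(** The partial sums are dominated by the constant [exp (|t| M)]. *)
Lemma cvg_moment_series d (T : measurableType d) (m : {measure set T -> \bar R})
    (f : T -> R) (M : R) (z : nat -> R) (g : R -> R) (t : R) :
  (m setT < +oo)%E -> measurable_fun setT f -> (forall x, `|f x| <= M) ->
  (forall k, `|z k| <= 1) ->
  (forall x, series (fun k => z k * x ^+ k / k`!%:R) @ \oo --> g x) ->
  series (fun k => z k * t ^+ k / k`!%:R * \int[m]_x (f x ^+ k)) @ \oo -->
    \int[m]_x g (t * f x).
Proof.
move=> mfin mf fM z1 zg.
have bf : bounded_measurable f by split => //; exists M.
have bk k : bounded_measurable (fun x => z k * t ^+ k / k`!%:R * (f x ^+ k)).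
  by apply: bounded_measurableM; [exact: bounded_measurable_cst|exact: bounded_measurableX].
rewrite (_ : series _ = fun n => \int[m]_x \sum_(0 <= k < n) (z k * t ^+ k / k`!%:R * f x ^+ k)); last first.
  apply/funext => n; rewrite bounded_Rintegral_sum// /series/=.
  by apply: eq_bigr => k _; rewrite bounded_RintegralZl//; exact: bounded_measurableX.
apply: (@bounded_cvg_Rintegral _ T R m mfin _ _ (expR (`|t| * M))).
- by move=> n; case: (bounded_measurable_sum (index_iota 0 n) xpredT bk).
- move=> n x; apply: le_trans (ler_norm_sum _ _ _) _.
  apply: (@le_trans _ _ (series (exp_coeff (`|t| * M)) n)).
    apply: ler_sum => k _; rewrite /exp_coeff/= !normrM normfV !normrX exprMn.
    rewrite (ger0_norm (ler0n _ _)) mulrAC ler_pM2r ?invr_gt0 ?ltr0n ?fact_gt0//.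
    apply: ler_pM; rewrite ?mulr_ge0 ?exprn_ge0//.
      by rewrite -[leRHS]mul1r ler_wpM2r// exprn_ge0.
    by rewrite lerXn2r ?nnegrE// (le_trans _ (fM x)).
  have M0 : 0 <= `|t| * M by rewrite mulr_ge0// (le_trans _ (fM x)).
  rewrite /expR; apply: nondecreasing_cvgn_le; last exact: is_cvg_series_exp_coeff.
  by apply: nondecreasing_series => k _ _; exact: exp_coeff_ge0.
- move=> x; have := zg (t * f x); apply: cvg_trans; apply: near_eq_cvg.
  by near=> n; rewrite /series/=; apply: eq_bigr => k _; rewrite exprMn; ring.
Unshelve. all: by end_near. Qed.

Lemma Rintegral_mscale d (T : measurableType d) (m : {measure set T -> \bar R})
    (c : {nonneg R}) (f : T -> R) : (m setT < +oo)%E -> bounded_measurable f ->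
  \int[mscale c m]_x f x = c%:num * \int[m]_x f x.
Proof.
move=> mfin bf; have i_f := bounded_measurable_integrable mfin bf.
have mf : measurable_fun setT (EFin \o f) by exact: measurable_int i_f.
rewrite /Rintegral integralE [in RHS]integralE.
rewrite !ge0_integral_mscale//; last 2 first.
- exact: measurable_funeneg.
- exact: measurable_funepos.
rewrite -muleBr//; last first.
  by rewrite fin_num_adde_defr//; exact: integrable_pos_fin_num.
by rewrite fineM// fin_numB integrable_pos_fin_num// integrable_neg_fin_num.
Qed.

Local Open Scope complex_scope.

Lemma ReD (x y : R[i]) : complex.Re (x + y) = complex.Re x + complex.Re y.
Proof. by case: x y => [? ?] [? ?]. Qed.

Lemma ImD (x y : R[i]) : complex.Im (x + y) = complex.Im x + complex.Im y.
Proof. by case: x y => [? ?] [? ?]. Qed.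

Lemma ReB (x y : R[i]) : complex.Re (x - y) = complex.Re x - complex.Re y.
Proof. by case: x y => [? ?] [? ?]. Qed.

Lemma ImB (x y : R[i]) : complex.Im (x - y) = complex.Im x - complex.Im y.
Proof. by case: x y => [? ?] [? ?]. Qed.

Lemma cvg_complex (s : nat -> R[i]) (l : R[i]) :
  complex.Re (s n) @[n --> \oo] --> complex.Re l ->
  complex.Im (s n) @[n --> \oo] --> complex.Im l ->
  (s : nat -> R[i]^o) @ \oo --> (l : R[i]^o).
Proof.
move=> /cvgrPdist_lt cr /cvgrPdist_lt ci; apply/cvgrPdist_lt => e e0.
have e0' := e0; rewrite ltcE/= in e0'; case/andP: e0' => /eqP ie re.
have e2 : 0 < complex.Re e / 2 by rewrite divr_gt0.
near=> n.
have h1 : `|complex.Re l - complex.Re (s n)| < complex.Re e / 2 by near: n; exact: cr.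
have h2 : `|complex.Im l - complex.Im (s n)| < complex.Re e / 2 by near: n; exact: ci.
rewrite normc_def ltcE/= -ie eqxx/= ReB ImB.
set a := complex.Re l - complex.Re (s n) in h1 *.
set b := complex.Im l - complex.Im (s n) in h2 *.
apply: (@le_lt_trans _ _ (`|a| + `|b|)); last by rewrite [ltRHS]splitr ltrD.
rewrite -[leRHS]ger0_norm ?addr_ge0// -sqrtr_sqr ler_sqrt ?sqr_ge0//.
by rewrite [leRHS]sqrrD !real_normK ?num_real// lerD2r lerDl mulrn_wge0// mulr_ge0.
Unshelve. all: by end_near. Qed.

Lemma cvg_series_complex (u : nat -> R[i]) (l : R[i]) :
  series (fun n => complex.Re (u n)) @ \oo --> complex.Re l ->
  series (fun n => complex.Im (u n)) @ \oo --> complex.Im l ->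
  series (u : nat -> R[i]^o) @ \oo --> (l : R[i]^o).
Proof.
move=> hr hi; apply: cvg_complex.
  rewrite (_ : (fun n => _) = series (fun n => complex.Re (u n)))//.
  apply/funext => n; rewrite /series/=; elim/big_ind2: _ => // x1 x2 y1 y2 <- <-.
  exact: ReD.
rewrite (_ : (fun n => _) = series (fun n => complex.Im (u n)))//.
apply/funext => n; rewrite /series/=; elim/big_ind2: _ => // x1 x2 y1 y2 <- <-.
exact: ImD.
Qed.

Lemma expi k : ('i : R[i]) ^+ k =
  ((~~ odd k)%:R * (-1) ^+ k./2) +i* ((odd k)%:R * (-1) ^+ k.-1./2).
Proof.
elim/ltn_ind: k => -[|[|k]] IH.
- by rewrite expr0 /= mul1r mul0r expr0.
- by rewrite expr1 /= mul0r mul1r expr0.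
rewrite 2!exprS mulrA -expr2 sqr_i mulN1r IH//= negbK.
apply/eqP; rewrite eq_complex/=; apply/andP; split; apply/eqP.
  by rewrite exprS mulN1r mulrN.
case: k {IH} => [|k]; first by rewrite /= !mul0r oppr0.
by rewrite (_ : uphalf k.+1 = (k./2).+1)// negbK exprS mulN1r mulrN.
Qed.

End MomentSeries.

(** * The characteristic function *)

Section CharacteristicFunction.
Variables (R : realType) (X : ptopologicalType).

(** For the one-block partition the normalising constant is
    [gamma b / gamma b], and it is the total mass of a probability. *)
Lemma gamma_intensity_neq0 (nu : {measure set borel X -> \bar R})
    (D : Prob R (Prob R X)) : (0 < nu setT)%E -> dirichlet_ferguson nu D ->
  gamma (fine (nu setT)) != 0.
Proof.
move=> nu0 [nuD _]; apply/eqP => g0.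
have pA : @borel_partition X 1 (fun=> setT).
  split => //; first by move=> i j _ _ _; rewrite (ord1 i) (ord1 j).
  by apply/seteqP; split => // x _; exists ord0.
have := nuD 0%N _ pA (fun=> nu0) setT measurableT.
rewrite /pushforward preimage_setT [X in X = _ -> _]probability_setT.
rewrite /dirichlet/= /dirichlet_density big_ord1 g0 !mul0r mulr0 => /eqP.
by rewrite eqe oner_eq0.
Qed.

Lemma compact_support_bounded (f : X -> R) : continuous f ->
  compact (closure [set x | f x != 0]) -> exists M : R, forall x, `|f x| <= M.
Proof.
move=> cf kf.
have /compact_bounded[M [_ Mf]] : compact (f @` closure [set x | f x != 0]).
  by apply: continuous_compact => //; exact: continuous_subspaceT.
exists (`|M| + 1) => x; have [->|fx0] := eqVneq (f x) 0; first by rewrite normr0 addr_ge0.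
apply: (Mf (`|M| + 1)); first by rewrite (le_lt_trans (ler_norm M))// ltrDl.
by exists x => //; exact: subset_closure.
Qed.

Local Open Scope complex_scope.

(** Taking all functions equal in [mixed_moment] identifies the [n]-th coefficient
    with the [n]-th moment of [int f d eta]; the real and imaginary parts of the
    series are the cosine and sine series under the integral. *)
Theorem characteristic_function (sigma : probability (borel X) R) (beta : R)
    (beta0 : 0 < beta) (D : Prob R (Prob R X)) :
  dirichlet_ferguson (mscale (NngNum (ltW beta0)) sigma) D ->
  forall f : X -> R, continuous f -> (exists M : R, forall x, `|f x| <= M) ->
  forall t : R,
    series (fun n : nat =>
      ('i * t%:C) ^+ n / n`!%:R * (n`!%:R / (rising beta n)%:C) *
      (cycle_index n (fun i => beta * \int[sigma]_x (f x ^+ i)))%:C : R[i]^o) @ \oo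
    --> (cintegral D (fun eta : Prob R X =>
           cexp ('i * t%:C * (\int[eta]_x f x)%:C)) : R[i]^o).
Proof.
move=> nuD f cf [M fM] t.
pose nu : {measure set borel X -> \bar R} := mscale (NngNum (ltW beta0)) sigma.
have {}nuD : dirichlet_ferguson nu D by [].
have nuT : nu setT = beta%:E.
  by rewrite /nu /= /mscale/= [sigma _]probability_setT mule1.
have nufin : (nu setT < +oo)%E by rewrite nuT ltry.
have nu0 : nu setT <> 0%E by rewrite nuT => -[] /eqP; rewrite gt_eqF.
have gb : gamma beta != 0.
  by have := @gamma_intensity_neq0 nu D; rewrite nuT; apply.
have rb n : rising beta n = \prod_(k < n) (beta + k%:R) by exact: risingE.
have rb0 n : rising beta n != 0.
  rewrite rb gt_eqF// prodr_gt0// => k _; exact: ltr_wpDr.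
have bf k : bounded_measurable (fun x : borel X => f x ^+ k).
  apply: bounded_measurableX; split; last by exists M.
  exact: continuous_borel_measurable.
have moment n : n`!%:R / rising beta n * cycle_index n (fun i => beta * \int[sigma]_x (f x ^+ i)) =
    \int[D]_eta ((\int[(eta : Prob R X)]_x f x) ^+ n).
  rewrite cycle_index_porbits.
  have := mixed_moment nufin nu0 nuD (f := fun _ : 'I_n => f) (fun=> cf) (ex_intro _ M (fun=> fM)).
  rewrite nuT -rb; under eq_Rintegral do rewrite prodr_const card_ord.
  have -> : \sum_(s : 'S_n) \prod_(c in porbits s) \int[nu]_x \prod_(j in c) f x =
      \sum_(s : 'S_n) \prod_(c in porbits s) (beta * \int[sigma]_x (f x ^+ #|c|)).
    apply: eq_bigr => s _; apply: eq_bigr => c _.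
    under eq_Rintegral do rewrite prodr_const.
    rewrite /nu Rintegral_mscale//; first by rewrite [X in (X < _)%E]probability_setT ltry.
  by move=> <-; field; rewrite rb0 pnatr_eq0 -lt0n fact_gt0.
have mI : measurable_fun setT (fun eta : borel (Prob R X) => \int[(eta : Prob R X)]_x f x).
  by apply: integral_eval_measurable => //; exists M.
have IM (eta : borel (Prob R X)) : `|\int[(eta : Prob R X)]_x f x| <= M.
  by apply: le_norm_Rintegral_prob => //; have := bf 1%N; under eq_fun do rewrite expr1.
have term n : ('i * t%:C) ^+ n / n`!%:R * (n`!%:R / (rising beta n)%:C) *
      (cycle_index n (fun i => beta * \int[sigma]_x (f x ^+ i)))%:C =
    'i ^+ n * (t ^+ n / n`!%:R * \int[D]_eta ((\int[(eta : Prob R X)]_x f x) ^+ n))%:C.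
  rewrite -moment exprMn -(rmorphXn (real_complex R)) -!(rmorph_nat (real_complex R)).
  rewrite -!(fmorphV (real_complex R)) -!mulrA -!(rmorphM (real_complex R)).
  by congr (_ * _%:C); ring.
have cintE : cintegral D (fun eta : Prob R X => cexp ('i * t%:C * (\int[eta]_x f x)%:C)) =
    (\int[D]_eta cos (t * \int[(eta : Prob R X)]_x f x)) +i*
    (\int[D]_eta sin (t * \int[(eta : Prob R X)]_x f x)).
  have e eta : cexp ('i * t%:C * (\int[(eta : Prob R X)]_x f x)%:C) =
      (cos (t * \int[(eta : Prob R X)]_x f x)) +i* (sin (t * \int[(eta : Prob R X)]_x f x)).
    rewrite /cexp; set x := Rintegral _ _ _.
    have -> : 'i * t%:C * x%:C = (0 : R) +i* (t * x).
      by apply/eqP; rewrite eq_complex/=; apply/andP; split; apply/eqP; ring.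
    rewrite /= expR0; apply/eqP; rewrite eq_complex/=.
    by apply/andP; split; apply/eqP; ring.
  by rewrite /cintegral; congr (_ +i* _); apply: eq_Rintegral => eta _; rewrite e.
rewrite cintE; apply: cvg_series_complex => /=.
- have := @cvg_moment_series R _ _ D (fun eta : borel (Prob R X) => \int[(eta : Prob R X)]_x f x) M
    (fun k => (~~ odd k)%:R * (-1) ^+ k./2) cos t (prob_fin D) mI IM.
  rewrite (_ : (fun n => complex.Re _) = (fun k => (~~ odd k)%:R * (-1) ^+ k./2 * t ^+ k / k`!%:R *
      \int[D]_eta ((\int[(eta : Prob R X)]_x f x) ^+ k))).
    apply => [k|x]; first by rewrite normrM normrX normrN1 expr1n mulr1 ger0_norm ?ler_nat// lern1 leq_b1.
    have -> : cos x = limn (series (cos_coeff x)) by rewrite unlock.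
    exact: is_cvg_series_cos_coeff.
  apply/funext => k; rewrite term expi /=; ring.
- have := @cvg_moment_series R _ _ D (fun eta : borel (Prob R X) => \int[(eta : Prob R X)]_x f x) M
    (fun k => (odd k)%:R * (-1) ^+ k.-1./2) sin t (prob_fin D) mI IM.
  rewrite (_ : (fun n => complex.Im _) = (fun k => (odd k)%:R * (-1) ^+ k.-1./2 * t ^+ k / k`!%:R *
      \int[D]_eta ((\int[(eta : Prob R X)]_x f x) ^+ k))).
    apply => [k|x]; first by rewrite normrM normrX normrN1 expr1n mulr1 ger0_norm ?ler_nat// lern1 leq_b1.
    have -> : sin x = limn (series (sin_coeff x)) by rewrite unlock.
    exact: is_cvg_series_sin_coeff.
  apply/funext => k; rewrite term expi /=; ring.
Qed.

End CharacteristicFunction.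

(** * Narrow convergence from an exhausting family *)

Section Portmanteau.
Variables (R : realType) (T : ptopologicalType).
Implicit Types (h g : T -> R) (H : set (T -> R)) (m : probability (borel T) R).

(** Lower bounds for the integrals of the elements of such an [H] yield lower
    bounds for the mass of every open set. *)
Definition exhausting H :=
  (forall h, H h -> continuous h /\ forall x, 0 <= h x <= 1) /\
  forall U : set T, open U -> exists s : nat -> T -> R,
    [/\ forall k, H (s k), forall k x, s k x <= \1_U x &
        forall x, s k x @[k --> \oo] --> (\1_U x : R)].

Lemma sum_steps_le (y : R) N : 0 <= y ->
  \sum_(i < N) (i.+1%:R < y)%R%:R <= y.
Proof.
move=> y0; elim: N => [|N IH]; first by rewrite big_ord0.
rewrite big_ord_recr/=; case: ltP => Ny; last by rewrite addr0.
apply: le_trans (ltW Ny); rewrite -natr1 lerD2r.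
rewrite -[leRHS](_ : \sum_(i < N) 1 = N%:R); last by rewrite sumr_const card_ord.
by apply: ler_sum => i _; case: (_ < _).
Qed.

Lemma sum_steps_ge (y : R) N : y <= N%:R ->
  y - 1 <= \sum_(i < N) (i.+1%:R < y)%R%:R.
Proof.
suff : (N%:R : R) <= \sum_(i < N) (i.+1%:R < y)%R%:R \/ y - 1 <= \sum_(i < N) (i.+1%:R < y)%R%:R.
  by move=> [h|//] yN; apply: (le_trans _ h); rewrite (le_trans _ yN)// gerBl.
elim: N => [|N IH]; first by left; rewrite big_ord0.
rewrite big_ord_recr/=; case: ltP => Ny /=.
  case: IH => h; first by left; rewrite -natr1 lerD2r.
  by right; rewrite (le_trans h)// lerDl.
right; rewrite addr0; case: IH => // h.
by rewrite lerBlDr (le_trans Ny)// -natr1 lerD2r.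
Qed.

(** Layer cake: up to [1 / n], the function [g] is the average of the indicators
    of the [n] open sets [g > i / n].  Replacing each indicator by an element of
    [H] below it that has almost the same integral against [m] gives a lower
    bound for the integral of [g] against any [m']. *)
Lemma exhausting_lower01 H m g (e : R) : exhausting H -> continuous g ->
  (forall x, 0 <= g x <= 1) -> 0 < e ->
  exists2 L : seq (T -> R), (forall h, h \in L -> H h) &
    forall m' : probability (borel T) R,
      (forall h, h \in L -> \int[m]_x h x - e < \int[m']_x h x) ->
      \int[m]_x g x - (e + e + e) < \int[m']_x g x.
Proof.
move=> [Hc Hx] cg g01 e0.
have [N Ne] : exists N : nat, N.+1%:R^-1 <= e.
  have : \forall k \near \oo, harmonic k <= e :> R by apply: (cvgr_le 0) => //; exact: cvg_harmonic.
  by move=> [k _ /(_ k (leqnn k))]; exists k.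
set n := N.+1 in Ne *.
have n0 : 0 < n%:R :> R by rewrite ltr0n.
have oU (i : 'I_n) : open [set x | i.+1%:R / n%:R < g x].
  by move/continuousP : cg => cg; apply: (cg [set y | i.+1%:R / n%:R < y]); exact: open_gt.
have /choice[s sP] (i : 'I_n) := Hx _ (oU i).
pose G k x := \sum_(i < n) n%:R^-1 * s i k x.
have bs i k : bounded_measurable (s i k : borel T -> R).
  have [/(_ k) /Hc [cs s01] _ _] := sP i.
  split; first exact: continuous_borel_measurable.
  by exists 1 => x; rewrite ger0_norm; case/andP: (s01 x).
have bns i k : bounded_measurable (fun x : borel T => n%:R^-1 * s i k x).
  by apply: bounded_measurableM => //; exact: bounded_measurable_cst.
have bG k : bounded_measurable (G k : borel T -> R).
  exact: bounded_measurable_sum.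
have bg : bounded_measurable (g : borel T -> R).
  split; first exact: continuous_borel_measurable.
  by exists 1 => x; rewrite ger0_norm; case/andP: (g01 x).
have stepE (i : 'I_n) x : \1_[set x | i.+1%:R / n%:R < g x] x =
    (i.+1%:R < n%:R * g x)%R%:R :> R.
  rewrite indicE; congr (nat_of_bool _)%:R.
  by apply/idP/idP; rewrite inE/= ltr_pdivrMr// [g x * _]mulrC.
have Gg k x : G k x <= g x.
  apply: (@le_trans _ _ (\sum_(i < n) n%:R^-1 * (i.+1%:R < n%:R * g x)%R%:R)).
    by apply: ler_sum => i _; rewrite ler_pM2l ?invr_gt0// -stepE; have [_ + _] := sP i.
  rewrite -mulr_sumr ler_pdivrMl//; apply: sum_steps_le.
  by rewrite mulr_ge0//; case/andP: (g01 x).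
pose S x : R := \sum_(i < n) n%:R^-1 * (i.+1%:R < n%:R * g x)%R%:R.
have gS x : g x - e <= S x.
  apply: (@le_trans _ _ (g x - n%:R^-1)); first by rewrite lerB.
  rewrite /S -mulr_sumr -(ler_pM2l n0) mulVKf ?gt_eqF// mulrBr mulfV ?gt_eqF//.
  by apply: sum_steps_ge; rewrite ler_piMr// ; case/andP: (g01 x).
have GS x : G k x @[k --> \oo] --> S x.
  apply: cvg_sum_fun => i; apply: cvgM; first exact: cvg_cst.
  by rewrite -stepE; have [_ _ +] := sP i; exact.
have GM k x : `|G k x| <= 1.
  rewrite ger0_norm; first by apply: (le_trans (Gg k x)); case/andP: (g01 x).
  apply: sumr_ge0 => i _; rewrite mulr_ge0 ?invr_ge0//.
  by have [/(_ k) /Hc [_ /(_ x) /andP[]]] := sP i.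
have IGS : \int[m]_x G k x @[k --> \oo] --> \int[m]_x S x.
  by apply: (@bounded_cvg_Rintegral _ (borel T) R m (prob_fin m) _ _ 1) => // k; case: (bG k).
have bS : bounded_measurable (S : borel T -> R).
  split.
    by apply: (measurable_fun_cvg (h := fun k => (G k : borel T -> R))) => // k; case: (bG k).
  exists 1 => x; have cn : `|G k x| @[k --> \oo] --> `|S x| by apply: cvg_norm; exact: GS.
  rewrite -(cvg_lim _ cn)//; apply: limr_le; first exact: cvgP cn.
  exact: nearW.
have IgS : \int[m]_x g x - e <= \int[m]_x S x.
  have bc : bounded_measurable (fun _ : borel T => - e) by exact: bounded_measurable_cst.
  apply: (@le_trans _ _ (\int[m]_x (g x - e))).
    rewrite bounded_RintegralD//; last exact: prob_fin.
    by rewrite Rintegral_cst// [X in _ * fine X]probability_setT mulr1.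
  by apply: le_bounded_Rintegral => //; [exact: prob_fin|exact: bounded_measurableD].
have [k Ik] : exists k, \int[m]_x S x - e < \int[m]_x G k x.
  have : \forall k \near \oo, \int[m]_x S x - e < \int[m]_x G k x.
    by apply: (cvgr_gt _ IGS); rewrite ltrBlDr ltrDl.
  by move=> [k _ /(_ k (leqnn k))]; exists k.
exists [seq s i k | i : 'I_n].
  by move=> h /mapP[i _ ->]; have [+ _ _] := sP i; exact.
move=> m' hm'.
have IG (m0 : probability (borel T) R) : \int[m0]_x G k x = \sum_(i < n) n%:R^-1 * \int[m0]_x s i k x.
  rewrite bounded_Rintegral_sum//; last exact: prob_fin.
  by apply: eq_bigr => i _; rewrite bounded_RintegralZl//; exact: prob_fin.
have h1 : \int[m']_x G k x <= \int[m']_x g x.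
  by apply: le_bounded_Rintegral => //; exact: prob_fin.
have h2 : \int[m]_x G k x - e <= \int[m']_x G k x.
  rewrite !IG -[e](_ : \sum_(i < n) n%:R^-1 * e = e); last first.
    by rewrite sumr_const card_ord -[LHS]mulr_natl mulVKf// gt_eqF.
  rewrite -sumrB; apply: ler_sum => i _; rewrite -mulrBr ler_pM2l ?invr_gt0//.
  by apply/ltW/(hm' (s i k)); apply: (map_f (fun i => s i k)); exact: mem_enum.
lra.
Qed.

Lemma exhausting_lower H m g (e : R) : exhausting H -> continuous g ->
  (exists M : R, forall x, `|g x| <= M) -> 0 < e ->
  exists2 L : seq (T -> R), (forall h, h \in L -> H h) &
  exists2 d : R, 0 < d &
    forall m' : probability (borel T) R,
      (forall h, h \in L -> \int[m]_x h x - d < \int[m']_x h x) ->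
      \int[m]_x g x - e < \int[m']_x g x.
Proof.
move=> Hx cg [M gM] e0.
pose N := Num.max M 1.
have N0 : 0 < N by rewrite lt_max ltr01 orbT.
have gN x : - N <= g x <= N by rewrite -ler_norml (le_trans (gM x))// le_max lexx.
pose f x := (g x + N) / (N + N).
have NN0 : 0 < N + N by rewrite addr_gt0.
have f01 x : 0 <= f x <= 1.
  have /andP[g1 g2] := gN x.
  rewrite divr_ge0 ?(ltW NN0)//=; last by rewrite -lerBlDr sub0r.
  by rewrite ler_pdivrMr// mul1r lerD2r.
have cf : continuous f.
  apply: continuous_funM; last exact: continuous_fun_cst.
  by apply: continuous_funD => //; exact: continuous_fun_cst.
pose d := e / (N + N) / 3.
have d0 : 0 < d by rewrite !divr_gt0.
have [L LH LP] := exhausting_lower01 m Hx cf f01 d0.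
exists L => //; exists d => // m' /LP.
have bf : bounded_measurable (f : borel T -> R).
  split; first exact: continuous_borel_measurable.
  by exists 1 => x; rewrite ger0_norm; case/andP: (f01 x).
have gE (m0 : probability (borel T) R) : \int[m0]_x g x = (N + N) * \int[m0]_x f x - N.
  rewrite -bounded_RintegralZl//; last exact: prob_fin.
  transitivity (\int[m0]_x ((N + N) * f x + - N)).
    by apply: eq_Rintegral => x _; rewrite mulrC divfK ?gt_eqF// addrK.
  rewrite bounded_RintegralD; last 3 first.
  - exact: prob_fin.
  - by apply: bounded_measurableM => //; exact: bounded_measurable_cst.
  - exact: bounded_measurable_cst.
  by rewrite Rintegral_cst// [X in _ * fine X]probability_setT mulr1.
have -> : d + d + d = e / (N + N) by rewrite /d; field; rewrite gt_eqF.
rewrite !gE -(ltr_pM2l NN0) mulrBr [X in _ - X]mulrC divfK ?gt_eqF//.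
by move=> h; rewrite addrAC ltrD2r.
Qed.

End Portmanteau.

Lemma cvg_initial_topology (S : choiceType) (U : topologicalType) (f : S -> U)
    (F : set_system S) (FF : Filter F) (s : S) :
  f @ F --> f s -> F --> (s : initial_topology f).
Proof.
move=> Ff A /=; rewrite nbhsE => -[B [[C oC <-] Cs] CA].
by apply: filterS CA _; apply: Ff; apply: open_nbhs_nbhs.
Qed.

Section NarrowConvergence.
Variables (R : realType) (T : ptopologicalType).

(** Lower bounds for bounded continuous functions follow from [exhausting_lower],
    and upper bounds by applying it to the opposite functions. *)
Lemma narrow_cvg_of_exhausting (I : Type) (F : set_system I) (FF : Filter F)
    (H : set (T -> R)) (P : I -> Prob R T) (m : Prob R T) : exhausting H ->
  (forall h, H h -> forall d : R, 0 < d ->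
    \forall i \near F, \int[m]_x h x - d < \int[P i]_x h x) ->
  P @ F --> m.
Proof.
move=> Hx PH.
have lower g (e : R) : continuous g -> (exists M : R, forall x, `|g x| <= M) -> 0 < e ->
    \forall i \near F, \int[m]_x g x - e < \int[P i]_x g x.
  move=> cg bg e0; have [L LH [d d0 LP]] := exhausting_lower m Hx cg bg e0.
  have : \forall i \near F, forall h, h \in L -> \int[m]_x h x - d < \int[P i]_x h x.
    elim: L LH {LP} => [|h L IH] LH; first exact: nearW.
    have {}IH : \forall i \near F, forall h, h \in L -> \int[m]_x h x - d < \int[P i]_x h x.
      by apply: IH => h' h'L; apply: LH; rewrite inE h'L orbT.
    have h1 : \forall i \near F, \int[m]_x h x - d < \int[P i]_x h x.
      by apply: PH d0; apply: LH; rewrite inE eqxx.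
    by apply: filterS2 h1 IH => i h1 h2 h'; rewrite inE => /predU1P[->//|]; exact: h2.
  by apply: filterS => i; exact: LP.
have cvg (g : bounded_continuous R T) :
    \int[P i]_x sval g x @[i --> F] --> \int[m]_x sval g x.
  case: g => g [cg bg] /=; apply/cvgrPdist_lt => e e0.
  have cNg : continuous (fun x => - g x) by move=> x; apply: cvgN; exact: cg.
  have bNg : exists M : R, forall x, `|- g x| <= M.
    by have [M gM] := bg; exists M => x; rewrite normrN.
  have bmg : bounded_measurable (g : borel T -> R).
    by split => //; exact: continuous_borel_measurable.
  have intN (m0 : probability (borel T) R) : \int[m0]_x (- g x) = - \int[m0]_x g x.
    rewrite -mulN1r -bounded_RintegralZl//; last exact: prob_fin.
    by apply: eq_Rintegral => x _; rewrite mulN1r.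
  apply: filterS2 (lower _ _ cg bg e0) (lower _ _ cNg bNg e0) => i.
  rewrite !intN ltr_norml => h1 h2; apply/andP; split; lra.
have cvgE : (fun i => narrow_eval (P i) : {ptws bounded_continuous R T -> R}) @ F -->
    (narrow_eval m : {ptws bounded_continuous R T -> R}).
  apply/cvg_sup => g; apply: cvg_initial_topology; exact: cvg.
exact: cvg_initial_topology cvgE.
Qed.

End NarrowConvergence.


(** * Countable exhausting families *)

Section Separating.
Variables (R : realType) (T : ptopologicalType) (K : countType).
Variable h : K -> T -> R.

Definition tent (n : nat) (s : seq K) (x : T) : R :=
  foldr (fun k a => Num.max (Num.min 1 (n%:R * h k x)) a) 0 s.

Hypothesis ch : forall k, continuous (h k).

Lemma tent01 n s x : 0 <= tent n s x <= 1.
Proof.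
elim: s => [|k s /andP[IH0 IH1]] /=; first by rewrite lexx ler01.
by rewrite le_max IH0 orbT ge_max IH1 ge_min lexx.
Qed.

Lemma continuous_tent n s : continuous (tent n s).
Proof.
elim: s => [|k s IH]; first exact: continuous_fun_cst.
apply: continuous_funmax => //; apply: continuous_funmin; first exact: continuous_fun_cst.
by apply: continuous_funM => //; exact: continuous_fun_cst.
Qed.

(** For the open set [U], take at stage [n] those among the first [n] functions
    that vanish outside [U], magnify them by [n], and take their maximum cut off
    at 1. *)
Lemma separating_exhausting :
  (forall (U : set T) x, open U -> U x ->
    exists k, 0 < h k x /\ forall y, ~ U y -> h k y = 0) ->
  exhausting [set tent ns.1 ns.2 | ns in [set: nat * seq K]].
Proof.
move=> sep; split=> [_ [[n s] _ <-]|U oU].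
  by split; [exact: continuous_tent|move=> x; exact: tent01].
pose inU k := `[< forall y, ~ U y -> h k y = 0 >].
pose s (n : nat) : seq K := [seq k <- pmap unpickle (iota 0 n) | inU k].
have tent_out n y : ~ U y -> tent n (s n) y = 0.
  move=> Uy; rewrite /s; elim: (pmap _ _) => //= k l IH.
  case: ifPn => //= /asboolP kU; rewrite IH (kU y Uy) mulr0 min_r ?ler01//.
  by rewrite maxxx.
exists (fun n => tent n (s n)); split.
- by move=> n; exists (n, s n).
- move=> n x; rewrite indicE; have [Ux|Ux] := pselect (U x).
    by rewrite mem_set//; case/andP: (tent01 n (s n) x).
  by rewrite memNset// tent_out.
- move=> x; rewrite indicE; have [Ux|Ux] := pselect (U x); last first.
    rewrite memNset//; under eq_fun do rewrite tent_out//; exact: cvg_cst.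
  rewrite mem_set//=; have [k [kx kU]] := sep U x oU Ux.
  apply: cvg_near_cst; near=> n.
  apply/eqP; rewrite eq_le; case/andP: (tent01 n (s n) x) => _ ->/=.
  have ks : k \in s n.
    rewrite mem_filter; apply/andP; split; first exact/asboolP.
    rewrite mem_pmap; apply/mapP; exists (pickle k); last by rewrite pickleK.
    by rewrite mem_iota/= add0n; near: n; exact: nbhs_infty_gt.
  have nh : 1 <= n%:R * h k x.
    by rewrite -ler_pdivrMr//; near: n; exact: nbhs_infty_ger.
  elim: (s n) ks => //= k' l IH; rewrite inE => /predU1P[<-|/IH {}IH].
    by rewrite le_max le_min lexx nh.
  by rewrite le_max IH orbT.
Unshelve. all: by end_near. Qed.

End Separating.

Section SeparatingFamily.
Variables (R : realType) (X : ptopologicalType).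
Hypothesis X2 : @second_countable X.
Hypothesis Xlc : locally_compact [set: X].
Hypothesis Xh : hausdorff_space X.

Lemma completely_regular_function (U : set X) (x : X) : open U -> U x ->
  exists g : X -> R, [/\ continuous g, forall y, 0 <= g y <= 1, g x = 1 &
    forall y, ~ U y -> g y = 0].
Proof.
move=> oU Ux.
have /(@uniform_separatorP _ R)[f [cf f01 f0 f1]] :=
  @locally_compact_completely_regular X R Xlc Xh x (~` U) (open_closedC oU) (fun h => h Ux).
have f01' y : 0 <= f y <= 1.
  have : (range f) (f y) by exists y.
  by move=> /f01/=; rewrite in_itv.
exists (fun y => 1 - f y); split.
- by apply: continuous_funB => //; exact: continuous_fun_cst.
- by move=> y; rewrite subr_ge0 lerBlDr lerDl andbC; exact: f01'.
- by rewrite (f0 (f x)) ?subr0//; exists x.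
- by move=> y Uy; rewrite (f1 (f y)) ?subrr//; exists y.
Qed.

(** One function for each pair of basic open sets: where possible, it is positive
    on the first set and zero off the second. *)
Lemma countable_separating : exists h : nat * nat -> X -> R,
  (forall k, continuous (h k)) /\
  forall (U : set X) x, open U -> U x ->
    exists k, 0 < h k x /\ forall y, ~ U y -> h k y = 0.
Proof.
have [B cB [Bo Bn]] := X2.
have [e eB] : exists e : nat -> set X, forall V, B V -> exists n, e n = V.
  have /countable_injP[phi phiI] := cB.
  exists (fun n => xget set0 [set V | B V /\ phi V = n]) => V BV; exists (phi V).
  have [BW phiW] := @xgetPex _ set0 [set W | B W /\ phi W = phi V] (ex_intro _ V (conj BV erefl)).
  by apply: phiI; rewrite ?inE.
pose sepf (ij : nat * nat) (g : X -> R) :=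
  [/\ continuous g, forall y, e ij.1 y -> 0 < g y &
      forall y, ~ e ij.2 y -> g y = 0].
have /choice[h hP] (ij : nat * nat) : exists g : X -> R,
    continuous g /\ ((exists g', sepf ij g') -> sepf ij g).
  have [[g sg]|ns] := pselect (exists g', sepf ij g').
    by exists g; split => //; case: sg.
  by exists (fun=> 0); split => //; exact: continuous_fun_cst.
exists h; split; first by move=> k; have [] := hP k.
move=> U x oU Ux.
have [V2 [BV2 V2x] V2U] : filter_from [set V | B V /\ V x] id U.
  by apply: Bn; exact: open_nbhs_nbhs.
have [g [cg g01 gx gV]] := completely_regular_function (Bo _ BV2) V2x.
have og : open [set y | 0 < g y].
  by move/continuousP : cg => cg; apply: (cg [set y | 0 < y]); exact: open_gt.
have [V1 [BV1 V1x] V1g] : filter_from [set V | B V /\ V x] id [set y | 0 < g y].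
  by apply: Bn; apply: open_nbhs_nbhs; split => //=; rewrite gx.
have [i ei] := eB _ BV1; have [j ej] := eB _ BV2.
exists (i, j); have [_] := hP (i, j).
case; first by exists g; split => //= y; [rewrite ei; exact: V1g|rewrite ej; exact: gV].
move=> _ h1 h2; split; first by apply: h1; rewrite /= ei.
by move=> y Uy; apply: h2 => /=; rewrite ej => /V2U.
Qed.

End SeparatingFamily.

(** * A countable basis of the narrow topology *)

Section Cylinders.
Variables (R : realType) (X : ptopologicalType) (J : countType).
Variable phi : J -> X -> R.

(** A continuous bump, positive exactly where all the listed integrals exceed
    their thresholds. *)
Definition cylinder (L : seq (J * rat)) (eta : Prob R X) : R :=
  foldr (fun jr a => Num.min (Num.max 0 (\int[eta]_x phi jr.1 x - ratr jr.2)) a) 1 L.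

Hypothesis phiH : exhausting [set phi j | j in [set: J]].

Let phi_bounded j : exists M : R, forall x, `|phi j x| <= M.
Proof.
have [_ h] := phiH.1 _ (ex_intro2 _ _ j I erefl).
by exists 1 => x; rewrite ger0_norm; case/andP: (h x).
Qed.

Let phi_continuous j : continuous (phi j).
Proof. by have [] := phiH.1 _ (ex_intro2 _ _ j I erefl). Qed.

Lemma cylinder_ge0 L eta : 0 <= cylinder L eta.
Proof. by elim: L => //= jr L IH; rewrite le_min IH le_max lexx. Qed.

Lemma continuous_cylinder L : continuous (cylinder L).
Proof.
elim: L => [|jr L IH]; first exact: continuous_fun_cst.
apply: continuous_funmin => //; apply: continuous_funmax; first exact: continuous_fun_cst.
apply: continuous_funB; last exact: continuous_fun_cst.
exact: integral_eval_continuous.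
Qed.

Lemma cylinder_cat L1 L2 eta :
  (0 < cylinder (L1 ++ L2) eta) = (0 < cylinder L1 eta) && (0 < cylinder L2 eta).
Proof. by elim: L1 => [|jr L IH] /=; rewrite ?ltr01// !lt_min IH andbA. Qed.

(** The sets [cylinder L > 0] that contain [eta] form a filter basis, and this
    filter converges to [eta] by [narrow_cvg_of_exhausting]. *)
Lemma cylinder_separating (G : set (Prob R X)) (eta : Prob R X) : open G -> G eta ->
  exists L, 0 < cylinder L eta /\ forall eta', ~ G eta' -> cylinder L eta' = 0.
Proof.
move=> oG Geta.
pose F := filter_from [set L | 0 < cylinder L eta]
  (fun L => [set eta' : Prob R X | 0 < cylinder L eta']).
have FF : Filter F.
  apply: filter_from_filter; first by exists [::] => /=; exact: ltr01.
  move=> L1 L2 /= h1 h2; exists (L1 ++ L2); first by rewrite /= cylinder_cat h1.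
  by move=> eta' /=; rewrite cylinder_cat => /andP[].
have Feta : id @ F --> eta.
  apply: narrow_cvg_of_exhausting phiH _ => _ [j _ <-] d d0.
  have [r] := @rat_in_itvoo R (\int[eta]_x phi j x - d) (\int[eta]_x phi j x)
    (ltac:(by rewrite ltrBlDr ltrDl)).
  rewrite in_itv/= => /andP[r1 r2]; exists [:: (j, r)].
    by rewrite /= lt_min ltr01 andbT lt_max subr_gt0 r2 orbT.
  move=> eta' /=; rewrite lt_min ltr01 andbT lt_max ltxx/= subr_gt0.
  exact: lt_trans.
have [L Leta LG] : F G by apply: Feta; exact: open_nbhs_nbhs.
exists L; split => // eta' nG; apply/eqP; rewrite eq_le cylinder_ge0 andbT leNgt.
by apply/negP => /LG.
Qed.

End Cylinders.

(** * The lattice generated by an algebra of bounded functions *)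

Section UniformClosure.
Variables (R : realType) (T : Type) (A : set (T -> R)).

Definition uniform_closure : set (T -> R) :=
  [set f | forall e : R, 0 < e -> exists2 a, A a & forall x, `|f x - a x| <= e].

Lemma sub_uniform_closure f : A f -> uniform_closure f.
Proof. by move=> Af e /ltW e0; exists f => // x; rewrite subrr normr0. Qed.

Lemma uniform_closure_closed f : (forall e : R, 0 < e ->
  exists2 g, uniform_closure g & forall x, `|f x - g x| <= e) -> uniform_closure f.
Proof.
move=> h e e0; have e20 : 0 < e / 2 by rewrite divr_gt0.
have [g ug fg] := h _ e20; have [a Aa ga] := ug _ e20; exists a => // x.
by rewrite [e]splitr -(subrKA (g x)) (le_trans (ler_normD _ _))// lerD.
Qed.

Hypothesis Acst : forall c : R, A (fun=> c).
Hypothesis AD : forall f g, A f -> A g -> A (fun x => f x + g x).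
Hypothesis AM : forall f g, A f -> A g -> A (fun x => f x * g x).
Hypothesis Abounded : forall f, A f -> exists M : R, forall x, `|f x| <= M.

Lemma uniform_closure_bounded f : uniform_closure f ->
  exists M : R, forall x, `|f x| <= M.
Proof.
move=> /(_ 1 ltr01)[a /Abounded[M aM] fa]; exists (1 + M) => x.
by rewrite -(subrK (a x) (f x)) (le_trans (ler_normD _ _))// lerD.
Qed.

Lemma uniform_closureD f g : uniform_closure f -> uniform_closure g ->
  uniform_closure (fun x => f x + g x).
Proof.
move=> uf ug e e0; have e20 : 0 < e / 2 by rewrite divr_gt0.
have [a Aa fa] := uf _ e20; have [b Ab gb] := ug _ e20.
exists (fun x => a x + b x); first exact: AD.
by move=> x; rewrite opprD addrACA [e]splitr (le_trans (ler_normD _ _))// lerD.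
Qed.

Lemma uniform_closureM f g : uniform_closure f -> uniform_closure g ->
  uniform_closure (fun x => f x * g x).
Proof.
move=> uf ug e e0.
have [M fM] := uniform_closure_bounded uf.
have {}fM x : `|f x| <= `|M| + 1 by rewrite (le_trans (fM x))// (le_trans (ler_norm M))// lerDl.
have M0 : 0 < `|M| + 1 by rewrite ltr_pwDr.
have [b Ab gb] := ug (e / 2 / (`|M| + 1)) (ltac:(by rewrite !divr_gt0)).
have [N bN] := Abounded Ab.
have {}bN x : `|b x| <= `|N| + 1 by rewrite (le_trans (bN x))// (le_trans (ler_norm N))// lerDl.
have N0 : 0 < `|N| + 1 by rewrite ltr_pwDr.
have [a Aa fa] := uf (e / 2 / (`|N| + 1)) (ltac:(by rewrite !divr_gt0)).
exists (fun x => a x * b x); first exact: AM.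
move=> x; rewrite (_ : _ - _ = f x * (g x - b x) + (f x - a x) * b x); last by ring.
rewrite [e]splitr (le_trans (ler_normD _ _))// lerD// normrM.
  by rewrite (le_trans (ler_pM _ _ (fM x) (gb x)))// mulrC divfK ?gt_eqF.
by rewrite (le_trans (ler_pM _ _ (fa x) (bN x)))// divfK ?gt_eqF.
Qed.

Lemma uniform_closure_cst (c : R) : uniform_closure (fun=> c).
Proof. exact: sub_uniform_closure. Qed.

(** Polynomials in [x] without constant term that converge to [|x|] uniformly on
    [[-1, 1]]; [|x|] is the nonnegative fixed point of the iteration. *)
Fixpoint abs_iter (n : nat) (x : R) : R :=
  if n is m.+1 then abs_iter m x + (x * x - abs_iter m x * abs_iter m x) / 2 else 0.

(** With [a = |x|], each step multiplies the error by at most [1 - a / 2], and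
    [(1 - a / 2) (1 + (n + 1) a / 2) <= 1 + n a / 2]. *)
Lemma abs_iter_bounds n x : `|x| <= 1 ->
  0 <= abs_iter n x <= `|x| /\ (`|x| - abs_iter n x) * (1 + n%:R * `|x| / 2) <= `|x|.
Proof.
rewrite (_ : abs_iter n x = abs_iter n `|x|); last first.
  elim: n => //= n ->; rewrite -(@normrM R x x) ger0_norm//.
  by rewrite -expr2 sqr_ge0.
have := normr_ge0 x; move: `|x| => a a0 a1.
elim: n => [|n [/andP[]]] /=; first by rewrite lexx a0 mul0r mul0r addr0 subr0 mulr1.
set q := abs_iter n a => q0 qa IH.
have qb : 0 <= q + (a * a - q * q) / 2 <= a by apply/andP; split; nra.
split => //; apply: le_trans IH.
rewrite -(natr1 n); have n0 : 0 <= n%:R :> R by rewrite ler0n.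
move: n%:R n0 => m m0.
have h1 : (a - (q + (a * a - q * q) / 2)) <= (a - q) * (1 - a / 2) by nra.
have c0 : 0 <= 1 + (m + 1) * a / 2 by rewrite addr_ge0// divr_ge0// mulr_ge0// addr_ge0.
apply: le_trans (ler_wpM2r c0 h1) _.
rewrite -[leLHS]mulrA; apply: ler_wpM2l; first by rewrite subr_ge0.
have h2 : 0 <= m * (a * a) by rewrite !mulr_ge0.
have h3 : 0 <= a * a by rewrite mulr_ge0.
lra.
Qed.

Lemma abs_iter_approx n x : `|x| <= 1 -> `| `|x| - abs_iter n.+1 x| <= 2 / n.+1%:R.
Proof.
move=> x1; have [/andP[q0 qa] h] := abs_iter_bounds n.+1 x1.
rewrite ger0_norm ?subr_ge0// ler_pdivlMr ?ltr0n//.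
move: h q0 qa; set q := abs_iter _ _ => h q0 qa.
have [x0|x0] := ltP 0 `|x|; last first.
  by rewrite (le_trans _ (ler0n _ 2))// mulr_le0_ge0 ?ler0n// subr_le0 (le_trans x0).
have n0 : 0 <= n.+1%:R :> R by rewrite ler0n.
move: n.+1%:R n0 h => m m0 h.
rewrite -(ler_pM2r x0); nra.
Qed.

(** After rescaling [f] into [[-1, 1]], apply the polynomials [abs_iter]. *)
Lemma uniform_closure_norm f : uniform_closure f -> uniform_closure (fun x => `|f x|).
Proof.
move=> uf; have [M fM] := uniform_closure_bounded uf.
pose N := `|M| + 1; have N0 : 0 < N by rewrite ltr_pwDr.
have fN x : `|f x| <= N by rewrite (le_trans (fM x))// (le_trans (ler_norm M))// lerDl.
pose g x := N^-1 * f x.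
have ug : uniform_closure g by apply: uniform_closureM => //; exact: uniform_closure_cst.
have g1 x : `|g x| <= 1 by rewrite normrM gtr0_norm ?invr_gt0// ler_pdivrMl// mulr1.
have uq n : uniform_closure (fun x => abs_iter n (g x)).
  elim: n => [|n IH] /=; first exact: uniform_closure_cst.
  apply: uniform_closureD => //; apply: uniform_closureM; last exact: uniform_closure_cst.
  apply: uniform_closureD; first exact: uniform_closureM.
  under eq_fun do rewrite -mulN1r.
  by apply: uniform_closureM; [exact: uniform_closure_cst|exact: uniform_closureM].
rewrite (_ : (fun x => _) = (fun x => N * `|g x|)); last first.
  by apply/funext => x; rewrite normrM gtr0_norm ?invr_gt0// mulVKf ?gt_eqF.
apply: uniform_closureM; first exact: uniform_closure_cst.
apply: uniform_closure_closed => e e0.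
have [n ne] : exists n : nat, 2 / n.+1%:R <= e.
  exists (Num.truncn (2 / e)); rewrite ler_pdivrMr ?ltr0n// mulrC -ler_pdivrMr//.
  exact/ltW/truncnS_gt.
exists (fun x => abs_iter n.+1 (g x)) => // x.
by apply: le_trans ne; exact: abs_iter_approx.
Qed.

Lemma uniform_closureB f g : uniform_closure f -> uniform_closure g ->
  uniform_closure (fun x => f x - g x).
Proof.
move=> uf ug; apply: uniform_closureD => //; under eq_fun do rewrite -mulN1r.
by apply: uniform_closureM => //; exact: uniform_closure_cst.
Qed.

Lemma uniform_closure_max f g : uniform_closure f -> uniform_closure g ->
  uniform_closure (fun x => Num.max (f x) (g x)).
Proof.
move=> uf ug; under eq_fun do rewrite maxr_absE.
apply: uniform_closureM; last exact: uniform_closure_cst.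
apply: uniform_closureD; first exact: uniform_closureD.
by apply: uniform_closure_norm; exact: uniform_closureB.
Qed.

Lemma uniform_closure_min f g : uniform_closure f -> uniform_closure g ->
  uniform_closure (fun x => Num.min (f x) (g x)).
Proof.
move=> uf ug; under eq_fun do rewrite minr_absE.
apply: uniform_closureM; last exact: uniform_closure_cst.
apply: uniform_closureB; first exact: uniform_closureD.
by apply: uniform_closure_norm; exact: uniform_closureB.
Qed.

End UniformClosure.

(** * Continuity in the intensity *)

Section PolynomialFunctionals.
Variables (R : realType) (X : ptopologicalType).

Definition monomial (l : seq (bounded_continuous R X)) (eta : Prob R X) : R :=
  \prod_(f <- l) \int[eta]_x sval f x.

Definition polynomial_functional : set (Prob R X -> R) :=
  [set Phi | exists p : seq (R * seq (bounded_continuous R X)),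
    Phi = fun eta => \sum_(t <- p) t.1 * monomial t.2 eta].

Lemma polynomial_functional_cst (c : R) : polynomial_functional (fun=> c).
Proof.
by exists [:: (c, [::])]; apply/funext => eta; rewrite big_seq1 /monomial big_nil mulr1.
Qed.

Lemma polynomial_functionalD f g : polynomial_functional f -> polynomial_functional g ->
  polynomial_functional (fun eta => f eta + g eta).
Proof.
by move=> [p ->] [q ->]; exists (p ++ q); apply/funext => eta; rewrite big_cat.
Qed.

Lemma polynomial_functionalM f g : polynomial_functional f -> polynomial_functional g ->
  polynomial_functional (fun eta => f eta * g eta).
Proof.
move=> [p ->] [q ->]; exists [seq (t.1 * u.1, t.2 ++ u.2) | t <- p, u <- q].
apply/funext => eta; rewrite big_allpairs_dep mulr_suml; apply: eq_bigr => t _.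
rewrite mulr_sumr; apply: eq_bigr => u _.
by rewrite /monomial/= big_cat/= mulrACA.
Qed.

Lemma polynomial_functional_eval f : continuous f ->
  (exists M : R, forall x, `|f x| <= M) ->
  polynomial_functional (fun eta => \int[eta]_x f x).
Proof.
move=> cf bf; exists [:: (1, [:: exist _ f (conj cf bf)])]; apply/funext => eta.
by rewrite big_seq1 /monomial big_seq1 mul1r.
Qed.

Lemma bounded_measurable_monomial l :
  bounded_measurable (monomial l : borel (Prob R X) -> R).
Proof.
apply: (bounded_measurable_prod l (fun=> true)) => -[f [cf [M fM]]]; split => /=.
  by apply: integral_eval_measurable => //; exists M.
exists M => eta; apply: le_norm_Rintegral_prob => //.
by split; [exact: continuous_borel_measurable|exists M].
Qed.

Lemma bounded_measurable_polynomial Phi : polynomial_functional Phi ->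
  bounded_measurable (Phi : borel (Prob R X) -> R).
Proof.
move=> [p ->]; apply: (bounded_measurable_sum p (fun=> true)) => t.
by apply: bounded_measurableM; [exact: bounded_measurable_cst|exact: bounded_measurable_monomial].
Qed.

Local Notation uc := (uniform_closure polynomial_functional).

Let ucC := uniform_closure_cst polynomial_functional_cst.
Let pfb Phi (h : polynomial_functional Phi) := (bounded_measurable_polynomial h).2.
Let ucM := uniform_closureM polynomial_functionalM pfb.
Let ucB := uniform_closureB polynomial_functional_cst polynomial_functionalD
  polynomial_functionalM pfb.
Let ucmax := uniform_closure_max polynomial_functional_cst polynomial_functionalD
  polynomial_functionalM pfb.
Let ucmin := uniform_closure_min polynomial_functional_cst polynomial_functionalD
  polynomial_functionalM pfb.

Lemma uniform_closure_cylinder (J : countType) (phi : J -> X -> R) (L : seq (J * rat)) :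
  (forall j, continuous (phi j)) ->
  (forall j, exists M : R, forall x, `|phi j x| <= M) -> uc (cylinder phi L).
Proof.
move=> cphi bphi; elim: L => [|jr L IH]; first exact: ucC.
apply: ucmin => //; apply: ucmax; first exact: ucC.
apply: ucB; last exact: ucC.
by apply: sub_uniform_closure; exact: polynomial_functional_eval.
Qed.

Lemma uniform_closure_tent (K : countType) (h : K -> Prob R X -> R) n (s : seq K) :
  (forall k, uc (h k)) -> uc (tent h n s).
Proof.
move=> uh; elim: s => [|k s IH]; first exact: ucC.
apply: ucmax => //; apply: ucmin; first exact: ucC.
by apply: ucM => //; exact: ucC.
Qed.

Lemma cvg_uniform_closure (I : Type) (F : set_system I) (FF : Filter F)
    (P : I -> Prob R (Prob R X)) (m : Prob R (Prob R X)) (Phi : Prob R X -> R) :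
  (forall l, \int[P i]_eta monomial l eta @[i --> F] --> \int[m]_eta monomial l eta) ->
  measurable_fun setT (Phi : borel (Prob R X) -> R) -> uc Phi ->
  \int[P i]_eta Phi eta @[i --> F] --> \int[m]_eta Phi eta.
Proof.
move=> cvgm mPhi uPhi.
have bPhi : bounded_measurable (Phi : borel (Prob R X) -> R).
  by split => //; exact: uniform_closure_bounded pfb _ uPhi.
apply/cvgrPdist_le => e e0; have e30 : 0 < e / 3 by rewrite divr_gt0.
have [Q [p Qp] Phip] := uPhi _ e30.
have bQ : bounded_measurable (Q : borel (Prob R X) -> R).
  by apply: bounded_measurable_polynomial; exists p.
have bt (t : R * seq (bounded_continuous R X)) :
    bounded_measurable (fun eta : borel (Prob R X) => t.1 * monomial t.2 eta).
  by apply: bounded_measurableM; [exact: bounded_measurable_cst|exact: bounded_measurable_monomial].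
have QE (m0 : Prob R (Prob R X)) :
    \int[m0]_eta Q eta = \sum_(t <- p) t.1 * \int[m0]_eta monomial t.2 eta.
  rewrite Qp (bounded_Rintegral_sum (prob_fin m0) p (fun=> true) bt).
  apply: eq_bigr => t _; rewrite (bounded_RintegralZl (prob_fin m0))//.
  exact: bounded_measurable_monomial.
have near0 (m0 : Prob R (Prob R X)) : `|\int[m0]_eta Phi eta - \int[m0]_eta Q eta| <= e / 3.
  have bNQ : bounded_measurable (fun eta : borel (Prob R X) => -1 * Q eta).
    by apply: bounded_measurableM => //; exact: bounded_measurable_cst.
  rewrite -mulN1r -(bounded_RintegralZl (prob_fin m0))// -(bounded_RintegralD (prob_fin m0))//.
  apply: le_norm_Rintegral_prob; first exact: bounded_measurableD.
  by move=> eta; rewrite mulN1r.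
have cQ : \int[P i]_eta Q eta @[i --> F] --> \int[m]_eta Q eta.
  rewrite QE; under eq_fun do rewrite QE.
  by apply: cvg_sum_fun => t; apply: cvgM; [exact: cvg_cst|exact: cvgm].
move/cvgrPdist_le : cQ => /(_ _ e30); apply: filterS => i h.
have := near0 m; have := near0 (P i); move: h; rewrite !ler_norml => h1 h2 h3.
by apply/andP; split; lra.
Qed.

End PolynomialFunctionals.

Section Continuity.
Variables (R : realType) (X : ptopologicalType).

Lemma integral_measure_continuous (f : X -> R) : continuous f ->
  (exists M : R, forall x, `|f x| <= M) ->
  continuous (fun nu : Meas R X => \int[sval nu]_x f x).
Proof.
move=> cf bf nu.
pose F : bounded_continuous R X := exist _ f (conj cf bf).
have c1 := @initial_continuous _ _ (fun mu : nz_finite_measure R X => @narrow_eval R X (sval mu)).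
exact: (continuous_comp (c1 nu) (@proj_continuous _ (fun _ : bounded_continuous R X => R) F _)).
Qed.

Lemma total_mass_continuous :
  continuous (fun nu : Meas R X => fine (sval nu setT)).
Proof.
have -> : (fun nu : Meas R X => fine (sval nu setT)) = fun nu => \int[sval nu]_x (1 : R).
  by apply/funext => nu; rewrite Rintegral_cst// mul1r.
apply: integral_measure_continuous; first exact: continuous_fun_cst.
by exists 1 => x; rewrite normr1.
Qed.

Lemma total_mass_gt0 (nu : Meas R X) : 0 < fine (sval nu setT).
Proof.
rewrite fine_gt0// lt0e measure_ge0 andbT; apply/andP; split.
  by apply/eqP; exact: (svalP nu).
by rewrite ltey_eq fin_num_measure.
Qed.

Variable DF : Meas R X -> Prob R (Prob R X).
Hypothesis DFP : forall nu : Meas R X, dirichlet_ferguson (sval nu) (DF nu).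

(** By [mixed_moment] the expectation of a monomial is a polynomial in integrals
    against [nu], divided by a product that is positive. *)
Lemma cvg_mixed_moment l (F : set_system (Meas R X)) (FF : Filter F) (nu : Meas R X) :
  F --> nu ->
  \int[DF nu']_eta monomial l eta @[nu' --> F] --> \int[DF nu]_eta monomial l eta.
Proof.
move=> Fnu.
pose n := size l; pose f (i : 'I_n) := sval (tnth (in_tuple l) i).
have cf i : continuous (f i) by have [] := svalP (tnth (in_tuple l) i).
have /choice[M fM] (i : 'I_n) : exists M : R, forall x, `|f i x| <= M.
  by have [] := svalP (tnth (in_tuple l) i).
have bfc (c : {set 'I_n}) : exists M : R, forall x, `|\prod_(j in c) f j x| <= M.
  exists (\prod_(j in c) M j) => x; rewrite normr_prod.
  by apply: ler_prod => i _; rewrite normr_ge0 fM.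
have prod0 (nu' : Meas R X) : 0 < \prod_(k < n) (fine (sval nu' setT) + k%:R).
  by apply: prodr_gt0 => k _; rewrite ltr_wpDr// total_mass_gt0.
have E (nu' : Meas R X) : \int[DF nu']_eta monomial l eta =
    (\prod_(k < n) (fine (sval nu' setT) + k%:R))^-1 *
    \sum_(s : 'S_n) \prod_(c in porbits s) \int[sval nu']_x \prod_(j in c) f j x.
  rewrite -(mixed_moment _ _ (DFP nu'))//; last 3 first.
  - by rewrite ltey_eq fin_num_measure.
  - exact: (svalP nu').
  - exists (\sum_i `|M i|) => i x; rewrite (le_trans (fM i x))// (bigD1 i)//=.
    by rewrite (le_trans (ler_norm _))// lerDl sumr_ge0.
  rewrite mulKf ?gt_eqF//; apply: eq_Rintegral => eta _.
  by rewrite /monomial big_tnth.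
rewrite E (funext E : (fun nu' => \int[DF nu']_eta monomial l eta) = _).
have cm : fine (sval (nu' : Meas R X) setT) @[nu' --> F] --> fine (sval nu setT).
  exact: cvg_comp Fnu (@total_mass_continuous nu).
apply: cvgM.
  apply: cvgV; first by rewrite gt_eqF.
  by apply: cvg_prod_fun => k; apply: cvgD; [exact: cm|exact: cvg_cst].
apply: cvg_sum_fun => s; apply: cvg_prod_fun => c.
have cfc : continuous (fun x => \prod_(j in c) f j x).
  by move=> x; apply: cvg_prod_fun => i; exact: cf.
have cI := integral_measure_continuous cfc (bfc c).
exact: cvg_comp Fnu (cI nu).
Qed.

Hypothesis X2 : @second_countable X.
Hypothesis Xlc : locally_compact [set: X].
Hypothesis Xh : hausdorff_space X.

(** The exhausting family built from the cylinder functions consists of uniform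
    limits of polynomials, whose expectations converge. *)
Theorem cvg_dirichlet_ferguson (F : set_system (Meas R X)) (FF : Filter F) (nu : Meas R X) :
  F --> nu -> DF @ F --> DF nu.
Proof.
move=> Fnu.
have [h [ch hsep]] := @countable_separating R X X2 Xlc Xh.
have phiH := separating_exhausting ch hsep.
set phi := (fun ns : nat * seq (nat * nat) => tent h ns.1 ns.2) in phiH.
have cphi j : continuous (phi j) by exact: continuous_tent.
have bphi j : exists M : R, forall x, `|phi j x| <= M.
  by exists 1 => x; rewrite ger0_norm; case/andP: (tent01 h j.1 j.2 x).
have cylH := separating_exhausting (continuous_cylinder phiH)
  (cylinder_separating phiH).
apply: narrow_cvg_of_exhausting cylH _ => _ [[n s] _ <-] d d0 /=.
set g := tent _ _ _.
have cI : \int[DF nu']_eta g eta @[nu' --> F] --> \int[DF nu]_eta g eta.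
  apply: cvg_uniform_closure.
  - by move=> l; exact: cvg_mixed_moment.
  - apply: (@continuous_borel_measurable R (Prob R X)); apply: continuous_tent.
    exact: continuous_cylinder.
  - by apply: uniform_closure_tent => L; exact: uniform_closure_cylinder.
by apply: (cvgr_gt _ cI); rewrite ltrBlDr ltrDl.
Qed.

Corollary dirichlet_ferguson_continuous : continuous DF.
Proof.
move=> nu; exact: (@cvg_dirichlet_ferguson (nbhs nu) (nbhs_filter nu) nu (fun=> id)).
Qed.

End Continuity.

Local Open Scope complex_scope.

Theorem theorem3p10 (R : realType) (X : ptopologicalType)
    (X2 : @second_countable X) (Xlc : locally_compact [set: X])
    (Xh : hausdorff_space X) :
  (forall (sigma : probability (borel X) R) (beta : R) (beta0 : 0 < beta)
      (D : Prob R (Prob R X)),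
    dirichlet_ferguson (mscale (NngNum (ltW beta0)) sigma) D ->
    forall f : X -> R, continuous f ->
      compact (closure [set x | f x != 0]) ->
      forall t : R,
        series (fun n : nat =>
          ('i * t%:C) ^+ n / n`!%:R *
          (n`!%:R / (rising beta n)%:C) *
          (cycle_index n
             (fun i => beta * \int[sigma]_x (f x ^+ i)))%:C : R[i]^o) @ \oo
        --> (cintegral D (fun eta : Prob R X =>
               cexp ('i * t%:C * (\int[eta]_x f x)%:C)) : R[i]^o)) /\
  (forall DF : Meas R X -> Prob R (Prob R X),
    (forall nu : Meas R X, dirichlet_ferguson (sval nu) (DF nu)) ->
    continuous DF).
Proof.
split=> [sigma beta beta0 D nuD f cf kf t|DF DFP].
  by apply: characteristic_function => //; exact: compact_support_bounded.
exact: dirichlet_ferguson_continuous.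
Qed.
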